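(* The minimum density $d^*(H_k)$ of a locating-dominating set of the infinite hexagonal grid $H_k$ with $k$ rows satisfies the following. (a) $d^*(H_1)=\tfrac25$, $d^*(H_2)=\tfrac38$, $d^*(H_4)=\tfrac{11}{32}$, $d^*(H_5)=\tfrac{12}{35}$. Moreover, there is a periodic locating-dominating set $\mathscr S_7$ of $H_7$ of period $22$ such that $d^*(H_7)\le d(\mathscr S_7,H_7)=\tfrac{26}{77}$, and there is a periodic locating-dominating set $\mathscr S_8$ of $H_8$ of period $20$ such that $d^*(H_8)\le d(\mathscr S_8,H_8)=\tfrac{27}{80}$. (b) For $k=3m$ with $m\ge1$, $d^*(H_{k})=d^*(H_{3m})=\tfrac13$. (c) For $k=3m+1$ with $m\ge3$, $d^*(H_k)=d^*(H_{3m+1})\le \dfrac{11m+4}{33m+11}$. (d) For $k=3m+2$ with $m\ge3$, $d^*(H_k)=d^*(H_{3m+2})\le \dfrac{10m+7}{30m+20}$.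
   Context: **Grid.** $H_k$ is the graph with vertex set $[k]\times\mathbb Z$, $[k]=\{1,\dots,k\}$ (first coordinate = row, second coordinate = column). Its edges are $\{(i,j),(i,j+1)\}$ for all $i\in[k]$, $j\in\mathbb Z$, and $\{(i,j),(i+1,j)\}$ for all $1\le i<k$ and $j\in\mathbb Z$ with $i+j$ even. **Locating-dominating sets.** For a graph $G=(V,E)$, $N(v)$ is the set of neighbors of $v$. A set $S\subseteq V$ is a locating-dominating set (LDS) if $N(v)\cap S\ne\emptyset$ for every $v\in V\setminus S$, and $N(u)\cap S\ne N(v)\cap S$ for all distinct $u,v\in V\setminus S$. **Density.** For an integer $r\ge1$, $N_r(v)=\{u\in V: 0<\mathrm{dist}(u,v)\le r\}$. For $S\subseteq V$, $d_v(S,G)=\limsup_{r\to\infty}|N_r(v)\cap S|/|N_r(v)|$ and $d(S,G)=\inf_{v\in V}d_v(S,G)$ is the density of $S$. The minimum density is $d^*(G)=\inf\{d(S,G): S\text{ is an LDS of }G\}$. **Periodicity.** An LDS $S$ of $H_k$ is periodic of period $p\ge1$ if for all $(i,j)$: $(i,j)\in S\iff(i,j+p)\in S$. *)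

(* Defs.v *)
From mathcomp Require Import all_boot all_order all_algebra.
From mathcomp Require Import finmap.
From mathcomp Require Import all_classical all_reals all_analysis.
From mathcomp Require Import zify.

Set Implicit Arguments.
Unset Strict Implicit.
Unset Printing Implicit Defensive.

Import Order.TTheory GRing.Theory Num.Theory.

Local Open Scope classical_set_scope.
Local Open Scope ring_scope.

(* In this section a graph is a symmetric irreflexive relation e on a         *)
(* possibly infinite vertex type V.                                           *)
Section Graphs.
Variables (R : realType) (V : choiceType) (e : rel V).
Implicit Types (u v : V) (S : set V).

Definition neighbors v : set V := [set u | e v u].

Definition lds S : Prop :=
  (forall v, ~ S v -> neighbors v `&` S !=set0) /\
  (forall u v, ~ S u -> ~ S v -> u <> v ->
     neighbors u `&` S <> neighbors v `&` S).

(* Least number of edges of a walk from u to v, and +oo if there is none.     *)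
Definition graph_dist u v : \bar R :=
  ereal_inf [set (size p)%:R%:E | p in [set p | path e u p /\ last u p = v]].

Definition punctured_ball (r : nat) v : set V :=
  [set u | (0 < graph_dist u v)%E /\ (graph_dist u v <= r%:R%:E)%E].

(* fset_set A has the elements of A only when A is finite, which is the case  *)
(* for the sets below in a locally finite graph.                              *)
Definition density_at v S : \bar R :=
  limn_esup (fun r : nat =>
    (#|` fset_set (punctured_ball r v `&` S)|%:R /
     #|` fset_set (punctured_ball r v)|%:R)%:E).

Definition density S : \bar R := ereal_inf [set density_at v S | v in setT].

Definition min_density : \bar R := ereal_inf [set density S | S in lds].

End Graphs.

Section HexGrid.
Variable k : nat.

Definition hex_vertex : Type := ('I_k * int)%type.

(* Rows are numbered from 1 to k, whereas ordinals start at 0.                *)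
Definition row_nb (v : hex_vertex) : nat := (val v.1).+1.
Definition col_nb (v : hex_vertex) : int := v.2.

(* The edges of the grid, each in one direction only.                         *)
Definition hex_arc (u v : hex_vertex) : bool :=
  (row_nb v == row_nb u) && (col_nb v == col_nb u + 1) ||
  [&& row_nb v == (row_nb u).+1, col_nb v == col_nb u &
      (2 %| (row_nb u)%:Z + col_nb u)%Z].

Definition hexgrid : rel hex_vertex := fun u v => hex_arc u v || hex_arc v u.

Lemma hexgrid_sym : symmetric hexgrid.
Proof. by move=> u v; rewrite /hexgrid orbC. Qed.

Lemma hexgrid_irr : irreflexive hexgrid.
Proof. by move=> u; rewrite /hexgrid /hex_arc; lia. Qed.

(* The period p need not be the least one.                                    *)
Definition col_periodic (p : nat) (S : set hex_vertex) : Prop :=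
  (0 < p)%N /\
  forall (i : 'I_k) (j : int), S (i, j) <-> S (i, j + p%:Z).

End HexGrid.

Arguments hexgrid k u v : clear implicits.

(* Main.v *)
Require Import Defs.
From mathcomp Require Import all_boot all_order all_algebra.
From mathcomp Require Import finmap.
From mathcomp Require Import all_classical all_reals all_analysis.
From mathcomp Require Import zify ring lra.

(* The grid has no 4-cycle, so S is locating-dominating iff it is dominating  *)
(* and every s in S has at most one neighbour u outside S with N(u) n S = {s} *)
(* (a "lone" neighbour of s).  Counting the edges between S and its           *)
(* complement column by column gives, up to telescoping terms,                *)
(*   6 |S| = 2 k n + #defects   over n columns,                               *)
(* where the defects are the elements of S without lone neighbour, those of   *)
(* degree 2 (vertices lacking a vertical neighbour), the edges inside S       *)
(* (counted twice) and the vertices outside S with three neighbours in S.     *)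
(* Hence every density is at least 1/3.  For k = 1, 2, 4, 5 the bound         *)
(* improves because a finite search shows that, from any column on, some      *)
(* bounded number m of columns contains at least m q / p defects, with q / p  *)
(* equal to 2/5, 1/2, 1/4, 2/7.                                               *)
(* The upper bounds come from periodic tilings.  A band of three rows (an     *)
(* alternating row, an empty one, an alternating one) can be added below any  *)
(* locating-dominating set: it adds one vertex per column.  Iterating this    *)
(* from k = 0, 7, 8 gives the densities for 3m, 3m + 1 and 3m + 2 rows.       *)

Set Implicit Arguments.
Unset Strict Implicit.
Unset Printing Implicit Defensive.

Import Order.TTheory GRing.Theory Num.Theory.
Local Open Scope classical_set_scope.
Local Open Scope ring_scope.

(** The locating condition becomes the local condition [locdom] on boolean columns; [lds_locdom] and
    [locdom_lds] pass between the two. Lower bounds: by [defects_sum], an average of q / p defects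
    per column forces density at least (2 k p + q) / (6 p k). For k = 3m the trivial average 0
    suffices. For k = 1, 2, 4, 5, [check_prefix_good] reduces the average to a computation: a
    left-to-right scan needs only a finite memory, and from every memory state all continuations are
    followed until enough defects have been seen. Upper bounds: [tiling_tableP] checks one period of
    an explicit set, and [tiling_extend] adds bands of local density 1/3. A punctured ball of radius
    r differs from the block of 2 r + 1 columns around its centre by boundedly many vertices, so
    [density_ge] and [density_le] read densities off column counts. *)

Local Notation nxt j := (j + 1)%R.
Local Notation prv j := (j - 1)%R.

(** * Patterns of rows and columns *)

(* Rows are numbered from 0, so the row index is one less than [row_nb].  A   *)
(* pattern of a grid with k rows is false outside rows 0, ..., k - 1.         *)
Definition pattern := nat -> int -> bool.

Definition below (k : nat) (f : pattern) := forall i j, f i j -> (i < k)%N.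

Definition down (i : nat) (j : int) : bool := (2 %| i.+1%:Z + j)%Z.

Definition vert (f : pattern) : pattern := fun i j =>
  if down i j then f i.+1 j else (0 < i)%N && f i.-1 j.

(* Given that the vertical neighbour of (i, j) is in f, the vertex (i, j) is a *)
(* lone neighbour of it.                                                      *)
Definition hlone k (f : pattern) : pattern := fun i j =>
  [&& (i < k)%N, ~~ f i j, ~~ f i (prv j) & ~~ f i (nxt j)].

(* [lone_left f i j] says that (i, j) is a lone neighbour of the vertex on its *)
(* left; [lone_vert], on the contrary, is about the lone vertical neighbour   *)
(* of (i, j).                                                                 *)
Definition lone_left (f : pattern) : pattern := fun i j =>
  [&& f i (prv j), ~~ f i j, ~~ f i (nxt j) & ~~ vert f i j].
Definition lone_right (f : pattern) : pattern := fun i j =>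
  [&& f i (nxt j), ~~ f i j, ~~ f i (prv j) & ~~ vert f i j].
Definition lone_vert k (f : pattern) : pattern := fun i j =>
  f i j && vert (hlone k f) i j.

Record locdom k (f : pattern) : Prop := Locdom {
  locdom_below : below k f;
  locdom_dom : forall i j, (i < k)%N ->
    [|| f i j, f i (prv j), f i (nxt j) | vert f i j];
  locdom_lone : forall i j, f i j ->
    (lone_right f i (prv j) + lone_left f i (nxt j) + lone_vert k f i j <= 1)%N
}.

Lemma downS i j : down i.+1 j = ~~ down i j.
Proof. rewrite /down; lia. Qed.

Lemma down_next i j : down i (nxt j) = ~~ down i j.
Proof. rewrite /down; lia. Qed.

Lemma sum_vertE n (g h : pattern) j : below n.+1 g ->
  (\sum_(i < n.+1) vert g i j * h i j =
   \sum_(i < n) (down i j) * (g i.+1 j * h i j + g i j * h i.+1 j))%N.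
Proof.
move=> bg.
have -> : (\sum_(i < n.+1) vert g i j * h i j =
   \sum_(i < n.+1) (down i j && g i.+1 j) * h i j +
   \sum_(i < n.+1) ([&& ~~ down i j, 0 < i & g i.-1 j]) * h i j)%N.
  rewrite -big_split; apply: eq_bigr => i _ /=; rewrite /vert.
  by case: (down i j); rewrite ?addn0.
rewrite big_ord_recr [X in (_ + X)%N]big_ord_recl /= andbF mul0n add0n.
have -> : g n.+1 j = false by apply/negP => /bg; rewrite ltnn.
rewrite andbF mul0n addn0 -big_split; apply: eq_bigr => i _ /=.
by rewrite downS negbK mulnDr !mulnA !mulnb.
Qed.

(** Double counting over vertical edges: by [sum_vertE] both sides are the same sum over these
    edges, symmetric in [g] and [h]. *)
Lemma sum_vert_swap k (g h : pattern) j : below k g -> below k h ->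
  (\sum_(i < k) vert g i j * h i j = \sum_(i < k) g i j * vert h i j)%N.
Proof.
case: k => [|n] bg bh; first by rewrite !big_ord0.
under [RHS]eq_bigr => i _ do rewrite mulnC.
rewrite !sum_vertE//; apply: eq_bigr => i _; congr (_ * _)%N.
by rewrite addnC mulnC [X in (_ + X)%N]mulnC.
Qed.

(** * Counting defects *)

Section Defects.
Variables (k : nat) (f : pattern).

Definition has_vert (i : nat) (j : int) : bool := vert (fun i _ => (i < k)%N) i j.

Definition open_right (i : nat) (j : int) :=
  [&& f i j, ~~ f i (nxt j) & ~~ vert f i (nxt j)].
Definition lone_lv (i : nat) (j : int) := lone_right f i (prv j) || lone_vert k f i j.

Definition triple (i : nat) (j : int) :=
  [&& ~~ f i j, f i (prv j), f i (nxt j) & vert f i j].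
(* A vertex of f without lone neighbour is detected early if its right        *)
(* neighbour cannot be lone, given the next column, and one column later      *)
(* otherwise.                                                                 *)
Definition late_unlone (i : nat) (j : int) :=
  [&& open_right i j, ~~ lone_lv i j & ~~ lone_left f i (nxt j)].
Definition early_unlone (i : nat) (j : int) :=
  [&& f i j, ~~ lone_lv i j & ~~ open_right i j].
Definition deg2 (i : nat) (j : int) := f i j && ~~ has_vert i j.
Definition hedge (i : nat) (j : int) := f i j && f i (nxt j).
Definition vedge (i : nat) (j : int) := f i j && vert f i j.

Definition colsum (g : pattern) (j : int) := (\sum_(i < k) g i j)%N.

(* The defects that are detected when column j + 2 is read. *)
Definition defects (j : int) :=
  (colsum triple (nxt j) + colsum late_unlone j + colsum early_unlone (nxt j) +
   colsum deg2 (nxt (nxt j)) + 2 * colsum hedge (nxt j) +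
   colsum vedge (nxt (nxt j)))%N.

(** [credit] and [debit] are the telescoping terms: they move counts of edges, elements and lone
    neighbours from one column to the next. *)
Definition credit (j : int) :=
  (colsum deg2 (nxt j) + colsum hedge j + colsum vedge (nxt j)
   + colsum (lone_right f) j + colsum f (nxt j))%N.
Definition debit (j : int) :=
  (colsum f j + colsum late_unlone j + colsum (lone_left f) (nxt j))%N.

Hypothesis ldf : locdom k f.

(** Each vertex outside the set demands 2. Summed, the demand is met by the edges leaving the set
    (three per element, minus degree defects and inner edges) and by the lone neighbours (at most
    one per element). [vedge] sees a vertical inner edge from both ends, hence its coefficient 1
    against 2 for [hedge]. *)
Lemma defects_balance (j : int) :
  (defects j + 2 * k + credit j + debit (nxt j) =
   6 * colsum f (nxt j) + credit (nxt j) + debit j)%N.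
Proof.
have bf := locdom_below ldf.
have bh : below k (hlone k f) by move=> i c /and4P[].
have bk : below k (fun i _ => (i < k)%N) by [].
have sumsC : (\sum_(i < k) (~~ f i (nxt j)) + colsum f (nxt j) = k)%N.
  rewrite -big_split /= -[RHS]card_ord -sum1_card.
  by apply: eq_bigr => i _; case: (f i _).
have sumL : (\sum_(i < k) (~~ f i (nxt j) && f i j) + colsum hedge j =
             colsum f j)%N.
  rewrite -big_split /=; apply: eq_bigr => i _; rewrite /hedge.
  by case: (f i (nxt j)); case: (f i j).
have sumR : (\sum_(i < k) (~~ f i (nxt j) && f i (nxt (nxt j))) +
             colsum hedge (nxt j) = colsum f (nxt (nxt j)))%N.
  rewrite -big_split /=; apply: eq_bigr => i _; rewrite /hedge.
  by case: (f i (nxt j)); case: (f i (nxt (nxt j))).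
have sumV : (\sum_(i < k) (~~ f i (nxt j) && vert f i (nxt j)) +
             colsum vedge (nxt j) + colsum deg2 (nxt j) = colsum f (nxt j))%N.
  transitivity (\sum_(i < k) vert f i (nxt j) * (i < k)%N + colsum deg2 (nxt j))%N.
    congr (_ + _)%N; rewrite -big_split /=; apply: eq_bigr => i _.
    by rewrite /vedge ltn_ord; case: (f i (nxt j)); case: (vert f i (nxt j)).
  rewrite (@sum_vert_swap k f (fun i _ => (i < k)%N)) // -big_split /=.
  apply: eq_bigr => i _; rewrite /deg2 -/(has_vert i (nxt j)).
  by case: (f i _); case: (has_vert i _).
have sumH : (\sum_(i < k) (vert f i (nxt j) && hlone k f i (nxt j)) =
             colsum (lone_vert k f) (nxt j))%N.
  transitivity (\sum_(i < k) vert f i (nxt j) * hlone k f i (nxt j))%N.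
    by apply: eq_bigr => i _; rewrite mulnb.
  by rewrite sum_vert_swap //; apply: eq_bigr => i _; rewrite mulnb.
(* A vertex outside the set with d neighbours in it, 1 <= d <= 3, satisfies 2 + [d = 3] = d +
   [d = 1]. *)
have main : (2 * \sum_(i < k) (~~ f i (nxt j)) + colsum triple (nxt j) =
   \sum_(i < k) (~~ f i (nxt j) && f i j) +
   \sum_(i < k) (~~ f i (nxt j) && f i (nxt (nxt j))) +
   \sum_(i < k) (~~ f i (nxt j) && vert f i (nxt j)) +
   colsum (lone_left f) (nxt j) + colsum (lone_right f) (nxt j) +
   \sum_(i < k) (vert f i (nxt j) && hlone k f i (nxt j)))%N.
  rewrite big_distrr /= -!big_split /=; apply: eq_bigr => i _.
  have := locdom_dom ldf (nxt j) (ltn_ord i).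
  rewrite /triple /lone_left /lone_right /hlone ltn_ord addrK /=.
  by case: (f i j); case: (f i (nxt j)); case: (f i (nxt (nxt j)));
    case: (vert f i (nxt j)).
(* Every element has exactly one lone neighbour or is an early or late defect. *)
have lone : (colsum f (nxt j) = colsum early_unlone (nxt j) +
    colsum late_unlone (nxt j) + colsum (lone_right f) j +
    colsum (lone_left f) (nxt (nxt j)) + colsum (lone_vert k f) (nxt j))%N.
  rewrite -!big_split /=; apply: eq_bigr => i _.
  have := @locdom_lone _ _ ldf i (nxt j).
  have Lf : lone_right f i j -> f i (nxt j) by case/and4P.
  have Vf : lone_vert k f i (nxt j) -> f i (nxt j) by case/andP.
  have Rf : lone_left f i (nxt (nxt j)) -> open_right i (nxt j).
    by rewrite /lone_left addrK /open_right; case/and4P => -> -> _ ->.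
  have Of : open_right i (nxt j) -> f i (nxt j) by case/and3P.
  rewrite /early_unlone /late_unlone /lone_lv addrK.
  move: Lf Vf Rf Of.
  case: (f i (nxt j)); case: (lone_right f i j); case: (lone_vert k f i (nxt j));
  case: (lone_left f i (nxt (nxt j))); case: (open_right i (nxt j)) => //=;
  by do ?[move=> /(_ isT)//|move=> _].
rewrite /defects /credit /debit; lia.
Qed.

End Defects.

Lemma colsum_le k (g : pattern) j : (colsum k g j <= k)%N.
Proof.
rewrite -[X in (_ <= X)%N]card_ord -sum1_card; apply: leq_sum => i _.
by case: (g _ _).
Qed.

Lemma defects_sum k f (j : int) n : locdom k f ->
  (\sum_(t < n) defects k f (j + t%:Z)%R + 2 * k * n <=
   6 * \sum_(t < n) colsum k f (j + t%:Z + 1)%R + 8 * k)%N.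
Proof.
move=> ldf.
suff : (\sum_(t < n) defects k f (j + t%:Z)%R + 2 * k * n + credit k f j
     + debit k f (j + n%:Z)%R =
   6 * \sum_(t < n) colsum k f (j + t%:Z + 1)%R + credit k f (j + n%:Z)%R
     + debit k f j)%N.
  have credit_le : (credit k f (j + n%:Z) <= 5 * k)%N.
    by rewrite /credit !(mulSn, mul0n) addn0 !addnA !leq_add ?colsum_le.
  have debit_le : (debit k f j <= 3 * k)%N.
    by rewrite /debit !(mulSn, mul0n) addn0 !addnA !leq_add ?colsum_le.
  by move: (\sum_(t < n) _)%N => D; move: (\sum_(t < n) _)%N => T; lia.
elim: n => [|n IH]; first by rewrite !big_ord0 addr0; lia.
rewrite !big_ord_recr /=.
have := defects_balance ldf (j + n%:Z)%R.
rewrite [j + n.+1%:Z](_ : _ = nxt (j + n%:Z)); last by rewrite -addrA -addn1 PoszD.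
by move: IH; move: (\sum_(t < n) _)%N => D; move: (\sum_(t < n) _)%N => T; lia.
Qed.

(** The window length may depend on the column, so that the search can close each branch at its own
    depth. *)
Definition prefix_good k f p q N := forall j : int, exists2 m : nat,
  (0 < m <= N)%N & (q * m <= p * \sum_(t < m) defects k f (j + t%:Z)%R)%N.

(** Good windows are cut off greedily from the left; the remainder of at most N columns costs at
    most q N. *)
Lemma prefix_good_sum k f p q N (j : int) n : prefix_good k f p q N ->
  (q * n <= p * \sum_(t < n) defects k f (j + t%:Z)%R + q * N)%N.
Proof.
move=> good; elim/ltn_ind: n j => n IH j.
have [leN|ltN] := leqP n N; first by rewrite (leq_trans _ (leq_addl _ _))// leq_mul.
have [m /andP[m0 mN] hm] := good j.
have := IH (n - m)%N _ (j + m%:Z); rewrite ltn_subrL m0 (leq_ltn_trans _ ltN)//.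
move/(_ isT).
have -> : (\sum_(t < n) defects k f (j + t%:Z)%R =
  \sum_(t < m) defects k f (j + t%:Z)%R +
  \sum_(t < n - m) defects k f (j + m%:Z + t%:Z)%R)%N.
  rewrite -!(big_mkord xpredT (fun t => defects k f (j + t%:Z))).
  rewrite (@big_cat_nat _ _ _ m) ?(leq_trans mN) 1?ltnW //=; congr (_ + _)%N.
  rewrite -(big_mkord xpredT (fun t => defects k f (j + m%:Z + t%:Z))).
  rewrite -{1}[m]add0n big_addn; apply: eq_bigr => i _.
  by congr (defects k f _); rewrite PoszD; lia.
move: hm; rewrite !mulnDr mulnBr.
have : (q * m <= q * n)%N by rewrite leq_mul // (leq_trans mN) // ltnW.
lia.
Qed.

Lemma locdom_density_ge k f p q N (j : int) n : locdom k f -> prefix_good k f p q N ->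
  ((2 * k * p + q) * n <=
   6 * p * \sum_(t < n) colsum k f (j + t%:Z)%R + (8 * k * p + q * N))%N.
Proof.
move=> ldf good.
have := prefix_good_sum (j - 1) n good; have := defects_sum (j - 1) n ldf.
have -> : (\sum_(t < n) colsum k f (j - 1 + t%:Z + 1)%R =
           \sum_(t < n) colsum k f (j + t%:Z)%R)%N.
  by apply: eq_bigr => t _; congr (colsum k f _); rewrite addrAC subrK.
move/(leq_mul (leqnn p)); rewrite !mulnDr.
move: (\sum_(t < n) _)%N => D; move: (\sum_(t < n) _)%N => T; lia.
Qed.

(** * The search for columns with few defects *)

(** Counterpart of [vert] on a column: entries joined by a vertical edge are exchanged, and an entry
    without such an edge becomes false. *)
Fixpoint vswap (b : bool) (x : seq bool) : seq bool :=
  match x with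
  | [::] => [::]
  | a :: x' => if b then
                 match x' with
                 | [::] => [:: false]
                 | c :: x'' => c :: a :: vswap true x''
                 end
               else false :: vswap true x'
  end.

Fixpoint map2 (A B C : Type) (h : A -> B -> C) (s : seq A) (t : seq B) :=
  match s, t with
  | a :: s', b :: t' => h a b :: map2 h s' t'
  | _, _ => [::]
  end.

Definition andv := map2 andb.
Definition diffv := map2 (fun a b : bool => if a then ~~ b else false).
Definition norv := map2 (fun a b : bool => if a then false else ~~ b).
Definition weight (s : seq bool) : nat := foldr (fun a n => if a then n.+1 else n) 0%N s.
Definition void (s : seq bool) : bool := foldr (fun a b => if a then false else b) true s.

(* The memory of a left-to-right scan: [st_down] tells whether row 0 has a    *)
(* vertical edge in the current column, [st_lone] marks the vertices of the   *)
(* previous column that have a lone neighbour on the left or vertically and   *)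
(* whose right neighbour may be lone too, and [st_right] the vertices of the  *)
(* current column whose left neighbour is lone.                               *)
Record state := State {
  st_down : bool;
  st_prev : seq bool;
  st_cur : seq bool;
  st_lone : seq bool;
  st_right : seq bool }.

(* Reads the next column y; the result is None if some vertex gets two lone   *)
(* neighbours, and otherwise contains the number of defects detected.         *)
Definition step (ones : seq bool) (s : state) (y : seq bool) : option (nat * state) :=
  let: State b l x pp ll := s in
  let v := vswap b x in
  let xv := norv x v in
  let ly := andv l y in
  let left := andv (diffv l y) xv in
  let right := andv (diffv y l) xv in
  let vert := andv x (vswap b (diffv (norv x l) y)) in
  if void (andv pp left) && void (andv ll vert) then
    let open0 := andv l xv in
    let lv := map2 orb ll vert in
    let vy := vswap (~~ b) y in
    let open1 := andv x (norv y vy) in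
    let d := (weight (andv (diffv ly x) v)
              + weight (diffv (diffv open0 pp) left)
              + weight (diffv (diffv x lv) open1)
              + weight (diffv y (vswap (~~ b) ones))
              + 2 * weight (andv x y) + weight (andv y vy))%N in
    Some (d, State (~~ b) x y (andv lv open1) right)
  else None.

(* Boolean vectors of cost at most b that are true at the forced positions.   *)
Fixpoint candidates (b : nat) (s : seq (bool * nat)) : seq (seq bool) :=
  match s with
  | [::] => [:: [::]]
  | (forced, c) :: s' =>
      (if forced then [::] else map (cons false) (candidates b s'))
      ++ (if (c <= b)%N then map (cons true) (candidates (b - c) s') else [::])
  end.

(** An entry is forced when the vertex on its left would otherwise be undominated. The cost counts
    only the defects that this entry alone decides (degree, horizontal edge, triple), hence a lower
    bound for the count in [step]. *)
Definition row_costs (ones : seq bool) (s : state) : seq (bool * nat) :=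
  let: State b l x _ _ := s in
  let v := vswap b x in
  map2 (fun hv lxv => let: (l, x, v) := lxv in
     (if x then false else if l then false else ~~ v,
      (~~ hv + (if x then 2 else if l then (if v then 1 else 0) else 0))%N))
   (vswap (~~ b) ones) (zip (zip l x) v).

Section Search.
Variables (p q : nat) (ones : seq bool).

(* [a] is q times the number of columns read so far minus p times the number  *)
(* of defects detected so far; a branch is closed when it drops to 0.         *)
Fixpoint search (n : nat) (s : state) (a : nat) : bool :=
  if n is n'.+1 then
    all (fun y =>
      if step ones s y is Some (d, s') then
        if (a + q <= p * d)%N then true else search n' s' (a + q - p * d)
      else true)
    (candidates ((a + q).-1 %/ p) (row_costs ones s))
  else false.
End Search.

(** With budget 0 and cost 1 outside [m], only the vectors contained in [m] survive. *)
Definition subsets (m : seq bool) : seq (seq bool) :=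
  candidates 0 (map (fun b => (false, nat_of_bool (~~ b))) m).

(* The constraints on [pp] and [ll] hold for all states met during a scan.    *)
(* Dropping [vswap (~~ b) l] makes the search fail for k = 2 and k = 5.       *)
Definition check (k p q N : nat) : bool :=
  let ones := nseq k true in
  all (fun b => all (fun l => all (fun x =>
    all (fun pp => all (fun ll => search p q ones N (State b l x pp ll) 0)
       (subsets (diffv (diffv x l) (vswap (~~ b) l))))
     (subsets (andv l (norv x (vswap b x)))))
   (subsets ones)) (subsets ones)) [:: true; false].


(** * The scan follows the columns of an actual pattern *)

Section Soundness.
Variables (k : nat) (f : pattern).

Definition column (g : pattern) (j : int) : seq bool := mkseq (fun i => g i j) k.

Definition state_at (j : int) : state :=
  State (down 0 (nxt j)) (column f j) (column f (nxt j))
    (column (fun i j => open_right f i j && lone_lv k f i j) j)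
    (column (lone_right f) j).

Lemma map2_mkseq (h : bool -> bool -> bool) (a b : nat -> bool) n :
  map2 h (mkseq a n) (mkseq b n) = mkseq (fun i => h (a i) (b i)) n.
Proof. by rewrite /mkseq; elim: (iota 0 n) => //= i s ->. Qed.

Lemma weight_mkseq (a : nat -> bool) n : weight (mkseq a n) = (\sum_(i < n) a i)%N.
Proof.
rewrite -(big_mkord xpredT (fun i => nat_of_bool (a i))) /index_iota subn0 /mkseq.
by elim: (iota 0 n) => [|i s IH]; rewrite ?big_nil // big_cons /= IH; case: (a i).
Qed.

Lemma void_mkseq (a : nat -> bool) n : (forall i, ~~ a i) -> void (mkseq a n).
Proof.
by move=> na; rewrite /mkseq; elim: (iota 0 n) => //= i s; rewrite (negPf (na i)).
Qed.

(** Rows are consumed in pairs, so the induction is on a bound for [n]. *)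
Lemma vswap_iota (g : pattern) j m n : down m j ->
    (forall i, (m + n <= i)%N -> ~~ g i j) ->
  vswap true [seq g i j | i <- iota m n] = [seq vert g i j | i <- iota m n].
Proof.
have [p] := ubnP n; elim: p => // p IH in m n *; case: n => [|[|n]] //= np dm gm.
  by rewrite /vert dm (negPf (gm _ _)) ?addn1.
have dm' : down m.+2 j by rewrite !downS negbK.
rewrite IH //; first by rewrite /vert dm downS dm.
  by rewrite ltnS in np; apply: leq_trans np.
by move=> i; rewrite !addSn => h; apply: gm; rewrite !addnS.
Qed.

Lemma vswap_column (g : pattern) j : below k g ->
  vswap (down 0 j) (column g j) = column (vert g) j.
Proof.
move=> bg; have out i : (k <= i)%N -> ~~ g i j.
  by move=> h; apply/negP => /bg; rewrite ltnNge h.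
rewrite /column /mkseq; case d0: (down 0 j); first by rewrite vswap_iota.
case: (k) out => [//|n] out /=; rewrite vswap_iota ?downS ?d0 //.
by rewrite /vert d0.
Qed.

Lemma column_ones j : nseq k true = column (fun i _ => (i < k)%N) j.
Proof.
apply: (@eq_from_nth _ false); first by rewrite size_nseq size_mkseq.
by move=> i; rewrite size_nseq => ik; rewrite nth_nseq nth_mkseq ik.
Qed.

Hypothesis ldf : locdom k f.

(** Along the columns of a [locdom] pattern the scan never fails, because a failure would exhibit
    two lone neighbours of one element. *)
Lemma step_state_at j :
  step (nseq k true) (state_at j) (column f (nxt (nxt j))) =
  Some (defects k f j, state_at (nxt j)).
Proof.
have bf := locdom_below ldf.
have bh : below k (hlone k f) by move=> i c /and4P[].
rewrite /step /state_at -!down_next /=.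
rewrite (column_ones (nxt (nxt j))) !vswap_column //.
have hloneE : diffv (norv (column f (nxt j)) (column f j)) (column f (nxt (nxt j)))
    = column (hlone k f) (nxt j).
  rewrite /column /norv /diffv !map2_mkseq.
  apply: (@eq_from_nth _ false) => [|i]; rewrite !size_mkseq // => ik.
  rewrite !nth_mkseq // /hlone ik addrK.
  by case: (f i (nxt j)); case: (f i j).
rewrite hloneE vswap_column // /column /norv /diffv /andv !map2_mkseq.
rewrite !void_mkseq /=; last 2 first.
- move=> i; apply/negP => /andP[ll /andP[fi vi]].
  by have := locdom_lone ldf fi; rewrite addrK ll /lone_vert fi vi addn1; case: lone_left.
- move=> i; apply/negP => /andP[/andP[/and3P[fi nf nv] lv] /andP[ny _]].
  have := locdom_lone ldf fi.
  rewrite [lone_left _ _ _]/lone_left addrK fi nf nv.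
  by move: ny lv; rewrite fi /lone_lv => ->; case: lone_right; case: lone_vert.
congr (Some (_, State _ _ _ _ _)).
- rewrite !weight_mkseq /defects /colsum -!addnA.
  congr (_ + (_ + (_ + (_ + _))))%N; apply: eq_bigr => i _; congr nat_of_bool.
  + rewrite /triple addrK.
    by case: (f i j); case: (f i (nxt j)); case: (f i (nxt (nxt j))).
  + rewrite /late_unlone /lone_left /open_right addrK; case: (lone_lv k f i j);
    by case: (f i j); case: (f i (nxt j)); case: (f i (nxt (nxt j))); case: vert.
  + rewrite /early_unlone /open_right /lone_lv /lone_vert addrK.
    case: (f i (nxt j)); case: (f i (nxt (nxt j))); case: (vert f i _);
    by case: (lone_right _ _ _); case: (vert (hlone _ _) _ _).


- apply: eq_map => i; rewrite /lone_lv /lone_vert /open_right addrK.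
  case: (f i (nxt j)); case: (f i (nxt (nxt j))); case: (vert f i _);
  by case: (lone_right _ _ _); case: (vert (hlone _ _) _ _).
- apply: eq_map => i; rewrite /lone_right addrK.
  by case: (f i j); case: (f i (nxt j)); case: (f i (nxt (nxt j))).
Qed.

End Soundness.

Lemma mem_candidates b (s : seq (bool * nat)) (y : seq bool) :
  all2 (fun r a => r.1 ==> a) s y ->
  (sumn (map2 (fun r (a : bool) => if a then r.2 else 0) s y) <= b)%N ->
  y \in candidates b s.
Proof.
elim: s b y => [|[nd c] s IH] b [|a y] //= /andP[nda sy] cb.
rewrite mem_cat; apply/orP; case: a => [|] in nda cb *.
  right; rewrite (leq_trans (leq_addr _ _) cb); apply: map_f; apply: IH => //.
  by rewrite leq_subRL // (leq_trans (leq_addr _ _) cb).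
by left; case: nd nda => // _; apply: map_f; apply: IH.
Qed.

Lemma all2_mkseq (S T : Type) (r : S -> T -> bool) a b n :
  (forall i, (i < n)%N -> r (a i) (b i)) -> all2 r (mkseq a n) (mkseq b n).
Proof.
move=> h; rewrite /mkseq; have : all (fun i => i < n)%N (iota 0 n).
  by apply/allP => i; rewrite mem_iota.
by elim: (iota 0 n) => //= i s IH /andP[/h-> /IH].
Qed.

Lemma sumn_map2_mkseq (S T : Type) (r : S -> T -> nat) a b n :
  sumn (map2 r (mkseq a n) (mkseq b n)) = (\sum_(i < n) r (a i) (b i))%N.
Proof.
rewrite -(big_mkord xpredT (fun i => r (a i) (b i))) /index_iota subn0 /mkseq.
by elim: (iota 0 n) => [|i s IH]; rewrite ?big_nil // big_cons /= IH.
Qed.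

Lemma zip_mkseq (S T : Type) (a : nat -> S) (b : nat -> T) n :
  zip (mkseq a n) (mkseq b n) = mkseq (fun i => (a i, b i)) n.
Proof. by rewrite /mkseq zip_map. Qed.

Lemma mem_subsets (m y : nat -> bool) n :
  (forall i, (i < n)%N -> y i -> m i) -> mkseq y n \in subsets (mkseq m n).
Proof.
move=> ym; apply: mem_candidates.
  by rewrite /mkseq -map_comp; apply: all2_mkseq.
rewrite /mkseq -map_comp leqn0 sumn_map2_mkseq; apply/eqP/big1 => i _ /=.
by case: ifP => // /(ym _ (ltn_ord i)) ->.
Qed.

Section SearchSoundness.
Variables (k : nat) (f : pattern).
Hypothesis ldf : locdom k f.

(** Pruning is safe: domination gives the forced entries, and the row costs add up to part of
    [defects]. *)
Lemma column_candidate j b : (defects k f j <= b)%N ->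
  column k f (nxt (nxt j)) \in
    candidates b (row_costs (nseq k true) (state_at k f j)).
Proof.
have bf := locdom_below ldf.
have map2_mkseqE (S T U : Type) (h : S -> T -> U) a c n :
    map2 h (mkseq a n) (mkseq c n) = mkseq (fun i => h (a i) (c i)) n.
  by rewrite /mkseq; elim: (iota 0 n) => //= i s ->.
move=> Db; rewrite /row_costs /state_at /= -!down_next.
rewrite (column_ones k (nxt (nxt j))) !vswap_column // /column !zip_mkseq map2_mkseqE.
apply: mem_candidates.
  apply: all2_mkseq => i ik /=; have := locdom_dom ldf (nxt j) ik.
  rewrite addrK.
  by case: (f i (nxt j)); case: (f i j); case: (vert f i _); case: (f i _).
rewrite sumn_map2_mkseq; apply: leq_trans Db.
apply: (@leq_trans (colsum k (deg2 k f) (nxt (nxt j)) +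
  2 * colsum k (hedge f) (nxt j) + colsum k (triple f) (nxt j))); last first.
  by rewrite /defects; lia.
rewrite /colsum big_distrr -!big_split /=; apply: leq_sum => i _.
rewrite /deg2 /hedge /triple addrK -/(has_vert k i _).
by case: (f i (nxt (nxt j))); case: (has_vert _ _ _); case: (f i (nxt j));
  case: (f i j); case: (vert f i _).
Qed.

Lemma search_sound p q n j a : (0 < p)%N ->
  search p q (nseq k true) n (state_at k f j) a ->
  exists2 m, (0 < m <= n)%N &
    (a + q * m <= p * \sum_(t < m) defects k f (j + t%:Z)%R)%N.
Proof.
move=> p0; elim: n j a => [//|n IH] j a /allP search_all.
have [good|bad] := leqP (a + q) (p * defects k f j).
  by exists 1%N; rewrite // muln1 big_ord1 addr0.
have := search_all (column k f (nxt (nxt j))).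
(* The branch is still open, so p d < a + q and d fits the budget (a + q - 1) / p. *)
rewrite step_state_at // leqNgt bad column_candidate; last first.
  by rewrite leq_divRL // mulnC; case: (a + q)%N bad.
move=> /(_ isT) /IH[m mn hm]; exists m.+1; first by case/andP: mn.
rewrite big_ord_recl /= addr0.
have -> : (\sum_(i < m) defects k f (j + (bump 0 i)%:Z)%R =
           \sum_(t < m) defects k f (nxt j + t%:Z)%R)%N.
  by apply: eq_bigr => i _; rewrite -addrA -PoszD.
move: hm bad; rewrite mulnS mulnDr; move: (p * \sum_(t < m) _)%N => T.
move: (p * defects k f j)%N => D; lia.
Qed.

Lemma check_prefix_good p q N : (0 < p)%N -> check k p q N ->
  prefix_good k f p q N.
Proof.
move=> p0 chk j; have bf := locdom_below ldf.
suff : search p q (nseq k true) N (state_at k f j) 0 by apply: search_sound.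
have mem_all (g : pattern) c : column k g c \in subsets (nseq k true).
  by rewrite (column_ones k 0); apply: mem_subsets.
have /allP/(_ (down 0 (nxt j))) := chk.
have -> : down 0 (nxt j) \in [:: true; false] by case: down.
move=> /(_ isT)/allP/(_ _ (mem_all f j))/allP/(_ _ (mem_all f (nxt j)))/allP.
move=> /(_ (column k (fun i j => open_right f i j && lone_lv k f i j) j)).
rewrite vswap_column // down_next negbK vswap_column // -down_next.
rewrite /column /andv /diffv /norv !map2_mkseq => root.
have /root/allP/(_ (column k (lone_right f) j)) :
    column k (fun i j => open_right f i j && lone_lv k f i j) j \in
    subsets (mkseq (fun i => f i j &&
      (if f i (nxt j) then false else ~~ vert f i (nxt j))) k).
  apply: mem_subsets => i _ /andP[/and3P[-> nf nv] _].
  by rewrite (negPf nf) nv.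
apply; apply: mem_subsets => i _ /and4P[-> nf _ nv].
by rewrite (negPf nf) nv.
Qed.

End SearchSoundness.

(** * Periodic tilings *)

Definition locdom_at k (f : pattern) i j : bool :=
  [|| f i j, f i (prv j), f i (nxt j) | vert f i j] &&
  (f i j ==> (lone_right f i (prv j) + lone_left f i (nxt j)
              + lone_vert k f i j <= 1)%N).

Definition periodic p (f : pattern) :=
  forall i (j q : int), f i (j + q * p%:Z) = f i j.

Lemma even_dvdz p : ~~ odd p -> (2 %| p%:Z)%Z.
Proof. by move=> p2; rewrite dvdzE /= dvdn2. Qed.

Lemma down_even i (j d : int) : (2 %| d)%Z -> down i (j + d) = down i j.
Proof. rewrite /down; lia. Qed.

Lemma locdom_at_periodic k p f i (j q : int) : ~~ odd p -> periodic p f ->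
  locdom_at k f i (j + q * p%:Z) = locdom_at k f i j.
Proof.
move=> p2 perf; set d := q * p%:Z.
have d2 : (2 %| d)%Z by rewrite dvdz_mull // even_dvdz.
have fN c i' : f i' (c + d - 1) = f i' (c - 1) by rewrite addrAC perf.
have fS c i' : f i' (c + d + 1) = f i' (c + 1) by rewrite addrAC perf.
have perd i' c : f i' (c + d) = f i' c by apply: perf.
have downd i' c : down i' (c + d) = down i' c by apply: down_even.
have vertd (g : pattern) : (forall i c, g i (c + d) = g i c) ->
    forall i c, vert g i (c + d) = vert g i c.
  by move=> gd i' c; rewrite /vert downd !gd.
have leftd i' c : lone_left f i' (c + d) = lone_left f i' c.
  by rewrite /lone_left fN fS perd vertd.
have rightd i' c : lone_right f i' (c + d) = lone_right f i' c.
  by rewrite /lone_right fN fS perd vertd.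
have loned i' c : lone_vert k f i' (c + d) = lone_vert k f i' c.
  rewrite /lone_vert perd vertd // => i'' c'.
  by rewrite /hlone fN fS perd.
rewrite /locdom_at perd fN fS vertd // loned.
by rewrite addrAC rightd [j + d + 1]addrAC leftd.
Qed.

Lemma locdom_atP k f : below k f ->
  (forall i j, (i < k)%N -> locdom_at k f i j) -> locdom k f.
Proof.
move=> bf at_f; split=> // i j.
  by move=> ik; have /andP[] := at_f i j ik.
by move=> fij; have /andP[_ /implyP/(_ fij)] := at_f i j (bf _ _ fij).
Qed.

(** An even period preserves the parity that places the vertical edges, so one period decides. *)
Lemma locdom_periodic k p f : (0 < p)%N -> ~~ odd p -> periodic p f ->
  below k f ->
  all (fun i => all (fun j : nat => locdom_at k f i j) (iota 0 p)) (iota 0 k) ->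
  locdom k f.
Proof.
move=> p0 p2 perf bf /allP chk; apply: locdom_atP => // i j ik.
rewrite (divz_eq j p) addrC locdom_at_periodic //.
have : (0 <= j %% p)%Z by apply: modz_ge0; lia.
have : (j %% p < p)%Z by apply: ltz_pmod; lia.
case: (j %% p)%Z => // r rp _.
have /chk/allP : i \in iota 0 k by rewrite mem_iota.
by apply; rewrite mem_iota.
Qed.

Definition table (t : seq (seq nat)) p : pattern := fun i j =>
  `|(j %% p%:Z)%Z|%N \in nth [::] t i.

Lemma table_periodic t p : periodic p (table t p).
Proof. by move=> i j q; rewrite /table addrC modzMDl. Qed.

Lemma table_below t p : below (size t) (table t p).
Proof.
move=> i j; rewrite /table; have [//|it] := ltnP i (size t).
by rewrite (nth_default _ it).
Qed.

(* In the added band, f is exactly at the vertices of the outer rows that are *)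
(* joined to the middle row.                                                  *)
Definition extend k (f : pattern) : pattern := fun i j =>
  if (i < k)%N then f i j
  else if i == k then down k j else (i == k.+2) && ~~ down k j.

Lemma extend_periodic k p f : ~~ odd p -> periodic p f ->
  periodic p (extend k f).
Proof.
move=> p2 perf i j q; rewrite /extend perf.
have -> : down k (j + q * p%:Z) = down k j.
  by rewrite down_even // dvdz_mull // even_dvdz.
by [].
Qed.

Lemma colsum_extend k f j : colsum k.+3 (extend k f) j = (colsum k f j).+1.
Proof.
rewrite /colsum !big_ord_recr /= /extend.
rewrite (eq_bigr (fun i : 'I_k => nat_of_bool (f i j))); last first.
  by move=> i _; rewrite ltn_ord.
rewrite ltnn eqxx !ltnNge leqnSn /= (leq_trans (leqnSn k) (leqnSn _)) /=.
by rewrite !eqxx (gtn_eqF (ltnSn k)) (gtn_eqF (leqnSn k.+1)); case: down; lia.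
Qed.

(** Each middle vertex of the band sees exactly its vertical neighbour, so each band element has its
    one lone neighbour there. The other vertices of the outer rows lie between two elements and are
    never lone. Old vertices below which the band is attached meet only non-elements of it, so the
    old part keeps its domination and gains no lone neighbour. *)
Lemma locdom_extend k f : locdom k f -> locdom k.+3 (extend k f).
Proof.
move=> ldf; have bf := locdom_below ldf.
have low i j : (i < k)%N -> extend k f i j = f i j by rewrite /extend => ->.
have r0 j : extend k f k j = down k j by rewrite /extend ltnn eqxx.
have r1 j : extend k f k.+1 j = false.
  by rewrite /extend; do ?case: ifP => //; lia.
have r2 j : extend k f k.+2 j = ~~ down k j.
  by rewrite /extend; do ?case: ifP => //; try lia; rewrite eqxx.
have out i j : extend k f i j -> (i < k.+3)%N.
  by rewrite /extend; case: ltnP => [|_]; [lia|case: eqP => [|_ /andP[/eqP]]; lia].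
have down_prev i j : down i (prv j) = ~~ down i j.
  by rewrite -[X in down i X = _]/(prv j) -{2}[j](subrK 1) down_next negbK.
have vert_low i j : (i < k)%N -> vert f i j -> vert (extend k f) i j.
  move=> ik; rewrite /vert; case: ifP => _.
    by move=> fi; rewrite low // (bf _ _ fi).
  by move=> /andP[-> fi]; rewrite low // (bf _ _ fi).
have rows i : (i < k.+3)%N -> [\/ (i < k)%N, i = k, i = k.+1 | i = k.+2].
  case: (ltnP i k) => [|ki] ik3; first by constructor 1.
  have : i = k \/ i = k.+1 \/ i = k.+2 by lia.
  by case=> [->|[->|->]]; [constructor 2|constructor 3|constructor 4].
have le_bool (a b : bool) : (a -> b) -> (a <= b)%N by case: a b => [] [] // /(_ isT).
have unvert i j : (i < k)%N -> ~~ vert (extend k f) i j -> ~~ vert f i j.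
  by move=> ik; apply: contra; apply: vert_low.
apply: locdom_atP => // i j /rows[ik|->|->|->]; rewrite /locdom_at.
- rewrite !low //; apply/andP; split.
    have := locdom_dom ldf j ik.
    by case: (f i j); case: (f i _); case: (f i _) => //= /(vert_low _ _ ik).
  apply/implyP => fij; have := locdom_lone ldf fij; apply: leq_trans.
  rewrite !leq_add // le_bool //.
  + by rewrite /lone_right !low // => /and4P[-> -> ->] /unvert ->.
  + by rewrite /lone_left !low // => /and4P[-> -> ->] /unvert ->.
  rewrite /lone_vert low // fij /= /vert; case: ifP => dij.
    rewrite /hlone; case: (ltngtP i.+1 k) => [ik1||ik1].
    - by rewrite !low // => /and4P[_ -> -> ->].
    - by rewrite ltnNge ik.
    (* The vertex of row k below (i, j) has both horizontal neighbours in the set. *)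
    - by rewrite ik1 !r0 down_prev -ik1 downS dij /= andbF.
  case/andP=> i0; have ik1 : (i.-1 < k)%N by lia.
  by rewrite i0 /hlone ik1 !low // => /and4P[_ -> -> ->].
- rewrite !r0 down_prev down_next /=; case dk: (down k j) => //=.
  rewrite /lone_right /lone_left !r0 !down_prev !down_next dk /=.
  by rewrite andbF leq_b1.
- by rewrite !r1 /vert downS r2 r0 /=; case: down.
- rewrite !r2 down_prev down_next negbK /=; case dk: (down k j) => //=.
  rewrite /lone_right /lone_left !r2 !down_prev !down_next dk /=.
  by rewrite andbF leq_b1.
Qed.

Lemma window_sum k p f (j : int) : periodic p f ->
  (\sum_(t < p) colsum k f (j + t%:Z)%R = \sum_(t < p) colsum k f t%:Z)%N.
Proof.
move=> perf; have per1 c : colsum k f (c + p%:Z) = colsum k f c.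
  by apply: eq_bigr => i _; rewrite -[p%:Z]mul1r perf.
pose W (c : int) := (\sum_(t < p) colsum k f (c + t%:Z)%R)%N.
have WS c : W (c + 1) = W c.
  rewrite /W; case: (p) per1 => [|n] per1; first by rewrite !big_ord0.
  rewrite big_ord_recr big_ord_recl /= addr0 addnC; congr (_ + _)%N.
    by rewrite -(per1 c) -addrA -PoszD add1n.
  by apply: eq_bigr => i _; rewrite -addrA -PoszD.
have Wn c (n : nat) : W (c + n%:Z) = W c.
  by elim: n => [|n IH]; rewrite ?addr0 // -addn1 PoszD addrA WS.
have W0 : W j = W 0.
  case: j => n; first by rewrite -[Posz n]add0r Wn.
  by rewrite -(Wn (Negz n) n.+1) NegzE addNr.
by rewrite -/(W j) W0; apply: eq_bigr => t _; rewrite add0r.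
Qed.

Lemma periodic_sum k p f N : (0 < p)%N ->
  (forall j : int, \sum_(t < p) colsum k f (j + t%:Z)%R = N)%N ->
  forall (j : int) n,
  (p * \sum_(t < n) colsum k f (j + t%:Z)%R <= N * n + p * (k * p) /\
   N * n <= p * \sum_(t < n) colsum k f (j + t%:Z)%R + N * p)%N.
Proof.
move=> p0 sumN j n; elim/ltn_ind: n j => n IH j.
have [np|pn] := ltnP n p.
  split; last by apply: leq_trans (leq_addl _ _); rewrite leq_mul2l ltnW ?orbT.
  apply: leq_trans (leq_addl _ _); rewrite leq_mul2l; apply/orP; right.
  apply: (@leq_trans (\sum_(t < n) k)); first by apply: leq_sum => t _; apply: colsum_le.
  by rewrite sum_nat_const card_ord mulnC leq_mul2l ltnW ?orbT.
have [] := IH (n - p)%N _ (j + p%:Z); first by rewrite ltn_subrL p0 (leq_trans p0).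
have -> : (\sum_(t < n) colsum k f (j + t%:Z)%R = N +
    \sum_(t < n - p) colsum k f (j + p%:Z + t%:Z)%R)%N.
  rewrite -(sumN j) -!(big_mkord xpredT (fun t => colsum k f (j + t%:Z))).
  rewrite (@big_cat_nat _ _ _ p) //=; congr (_ + _)%N.
  rewrite -(big_mkord xpredT (fun t => colsum k f (j + p%:Z + t%:Z))).
  rewrite -{1}[p]add0n big_addn; apply: eq_bigr => i _.
  by congr (colsum k f _); rewrite PoszD; lia.
have := leq_mul (leqnn N) pn; rewrite mulnBr mulnDr [(p * N)%N]mulnC.
by move: (\sum_(t < _) _)%N => T; lia.
Qed.

(* N is the number of vertices per period of p columns. *)
Definition tiling k p N := exists f,
  [/\ locdom k f, periodic p f &
      forall j : int, (\sum_(t < p) colsum k f (j + t%:Z)%R = N)%N].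

Definition tiling_table (t : seq (seq nat)) p N : bool :=
  let k := size t in
  all (fun i => all (fun j : nat => locdom_at k (table t p) i j) (iota 0 p))
    (iota 0 k)
  && (sumn (map (fun j : nat =>
        sumn (mkseq (fun i => nat_of_bool (table t p i j)) k)) (iota 0 p)) == N).

Lemma tiling_tableP t p N : (0 < p)%N -> ~~ odd p -> tiling_table t p N ->
  tiling (size t) p N.
Proof.
move=> p0 p2 /andP[chk /eqP sumN]; exists (table t p).
split; [|exact: table_periodic|].
  apply: locdom_periodic chk => //; first exact: table_periodic.
  exact: table_below.
move=> j; rewrite window_sum; last exact: table_periodic.
rewrite -sumN sumnE big_map -(big_mkord xpredT (fun t0 => colsum _ _ t0%:Z)).
rewrite /index_iota subn0; apply: eq_bigr => c _.
rewrite sumnE big_map /colsum.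
by rewrite -(big_mkord xpredT (fun i => nat_of_bool (table t p i c))) /index_iota subn0.
Qed.

Lemma tiling0 : tiling 0 2 0.
Proof.
exists (fun _ _ => false); split=> [|//|j].
  by split=> // i j.
by rewrite big1 // => t _; rewrite /colsum big_ord0.
Qed.

Lemma tiling_extend k p N m : tiling k p N -> ~~ odd p ->
  tiling (k + 3 * m) p (N + p * m).
Proof.
move=> tkN p2; elim: m => [|m [f [ldf perf sumf]]]; first by rewrite !muln0 !addn0.
exists (extend (k + 3 * m) f).
have -> : (k + 3 * m.+1 = (k + 3 * m).+3)%N by lia.
split; [exact: locdom_extend|exact: extend_periodic|] => j.
rewrite (eq_bigr (fun t : 'I_p => colsum (k + 3 * m) f (j + t%:Z)%R + 1)%N).
  by rewrite big_split /= sumf sum1_card card_ord mulnS; lia.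
by move=> t _; rewrite colsum_extend addn1.
Qed.

(** * Locating-dominating sets of the grid *)

Lemma hexgridE k (u v : hex_vertex k) : hexgrid k u v =
  (v.1 == u.1 :> nat) && ((v.2 == u.2 + 1) || (v.2 == u.2 - 1)) ||
  (v.2 == u.2) && (if down u.1 u.2 then v.1 == u.1.+1 :> nat
                   else u.1 == v.1.+1 :> nat).
Proof.
case: u v => [[a ak] c] [[b bk] d].
by rewrite /hexgrid /hex_arc /row_nb /col_nb /down /=; case: ifP; lia.
Qed.

Lemma hex_vertex_eq k (u v : hex_vertex k) :
  u.1 = v.1 :> nat -> u.2 = v.2 -> u = v.
Proof. by case: u v => [a c] [b d] /= /val_inj -> ->. Qed.

(** Consequence used below: two vertices outside S with the same nonempty trace on S have a single
    common neighbour as that trace. *)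
Lemma hexgrid_square_free k (u v s t : hex_vertex k) :
  hexgrid k u s -> hexgrid k u t -> hexgrid k v s -> hexgrid k v t ->
  u <> v -> s = t.
Proof.
move=> us ut vs vt uv; apply: contrapT => st; apply: uv.
have {}st : (s.1 != t.1 :> nat) || (s.2 != t.2).
  apply/negPn/negP; rewrite negb_or !negbK => /andP[/eqP h /eqP h'].
  exact/st/hex_vertex_eq.
move: us ut vs vt st; rewrite !hexgridE.
move: u v s t => [[a a'] a2] [[b b'] b2] [[c c'] c2] [[d d'] d2] /=.
rewrite /down.
case: ifP => dwu; case: ifP => dwv us ut vs vt st; apply: hex_vertex_eq => /=; lia.
Qed.

Definition pattern_of k (S : set (hex_vertex k)) : pattern := fun i j =>
  `[< exists ik : (i < k)%N, S (Ordinal ik, j) >].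

Section LocatingDominating.
Variables (k : nat) (S : set (hex_vertex k)).
Let f := pattern_of S.

Lemma pattern_ofE (v : hex_vertex k) : f v.1 v.2 = `[< S v >].
Proof.
case: v => i j; rewrite /f /pattern_of /=; apply: asbool_equiv_eq.
split=> [[ik]|Sij]; first by rewrite (val_inj (erefl : val (Ordinal ik) = val i)).
by exists (ltn_ord i); rewrite (val_inj (erefl : val (Ordinal (ltn_ord i)) = val i)).
Qed.

Lemma pattern_of_below : below k f.
Proof. by move=> i j /asboolP[]. Qed.

Lemma pattern_ofP i j : reflect (exists ik : (i < k)%N, S (Ordinal ik, j)) (f i j).
Proof. exact: asboolP. Qed.

Definition sole (u s : hex_vertex k) : Prop :=
  [/\ ~ S u, hexgrid k u s, S s & forall t, hexgrid k u t -> S t -> t = s].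

Lemma vertP (g : pattern) i j : below k g -> (i < k)%N ->
  reflect (exists2 t : hex_vertex k, g t.1 t.2 & t.2 = j /\
     (if down i j then t.1 = i.+1 :> nat else i = t.1.+1 :> nat))
    (vert g i j).
Proof.
move=> bg ik; rewrite /vert; case: ifP => _; apply: (iffP idP).
- by move=> gt; have tk := bg _ _ gt; exists (Ordinal tk, j).
- by case=> t gt [<- <-].
- case/andP=> i0 gt; have tk := bg _ _ gt.
  by exists (Ordinal tk, j) => //=; rewrite prednK.
- by case=> t gt [<- ->].
Qed.

Lemma hexgrid_cases (u t : hex_vertex k) : hexgrid k u t ->
  [\/ t.1 = u.1 :> nat /\ t.2 = u.2 + 1, t.1 = u.1 :> nat /\ t.2 = u.2 - 1 |
   t.2 = u.2 /\ (if down u.1 u.2 then t.1 = u.1.+1 :> nat else u.1 = t.1.+1 :> nat)].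
Proof.
rewrite hexgridE => /orP[/andP[/eqP-> /orP[]/eqP->]|/andP[/eqP-> h]].
- by constructor 1.
- by constructor 2.
- by constructor 3; split=> //; move: h; case: ifP => _ /eqP.
Qed.

Lemma lone_rightP (u s : hex_vertex k) : s.1 = u.1 :> nat -> s.2 = u.2 + 1 ->
  reflect (sole u s) (lone_right f u.1 u.2).
Proof.
move=> s1 s2; apply: (iffP and4P).
  case=> fs fu fl fv; split.
  - by apply/asboolPn; rewrite -pattern_ofE.
  - by rewrite hexgridE s1 s2 !eqxx.
  - by apply/asboolP; rewrite -pattern_ofE s1 s2.
  move=> t ut /asboolP; rewrite -pattern_ofE => ft.
  case: (hexgrid_cases ut) => [[t1 t2]|[t1 t2]|tv].
  - by apply: hex_vertex_eq; rewrite ?t1 ?t2.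
  - by move: ft fl; rewrite t1 t2 => ->.
  - by case/negP: fv; apply/(vertP _ pattern_of_below (ltn_ord _)); exists t.
case=> Su us Ss uniq_s; split.
- by rewrite -s1 -s2 pattern_ofE; apply/asboolP.
- by rewrite pattern_ofE; apply/asboolPn.
- apply/negP => /pattern_ofP[ik St].
  have /(uniq_s _)/(_ St)/(congr1 snd)/= :
    hexgrid k u (Ordinal ik, u.2 - 1) by rewrite hexgridE !eqxx orbT.
  by rewrite s2; lia.
- apply/negP => /(vertP _ pattern_of_below (ltn_ord _))[t ft [t2 tv]].
  have ut : hexgrid k u t.
    by rewrite hexgridE t2 eqxx; move: tv; case: ifP => _ ->; rewrite eqxx orbT.
  move: ft; rewrite pattern_ofE => /asboolP/(uniq_s _ ut) ts.
  by move: t2; rewrite ts s2; lia.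
Qed.

Lemma lone_leftP (u s : hex_vertex k) : s.1 = u.1 :> nat -> s.2 = u.2 - 1 ->
  reflect (sole u s) (lone_left f u.1 u.2).
Proof.
move=> s1 s2; apply: (iffP and4P).
  case=> fs fu fr fv; split.
  - by apply/asboolPn; rewrite -pattern_ofE.
  - by rewrite hexgridE s1 s2 !eqxx orbT.
  - by apply/asboolP; rewrite -pattern_ofE s1 s2.
  move=> t ut /asboolP; rewrite -pattern_ofE => ft.
  case: (hexgrid_cases ut) => [[t1 t2]|[t1 t2]|tv].
  - by move: ft fr; rewrite t1 t2 => ->.
  - by apply: hex_vertex_eq; rewrite ?t1 ?t2.
  - by case/negP: fv; apply/(vertP _ pattern_of_below (ltn_ord _)); exists t.
case=> Su us Ss uniq_s; split.
- by rewrite -s1 -s2 pattern_ofE; apply/asboolP.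
- by rewrite pattern_ofE; apply/asboolPn.
- apply/negP => /pattern_ofP[ik St].
  have /(uniq_s _)/(_ St)/(congr1 snd)/= :
    hexgrid k u (Ordinal ik, u.2 + 1) by rewrite hexgridE !eqxx.
  by rewrite s2; lia.
- apply/negP => /(vertP _ pattern_of_below (ltn_ord _))[t ft [t2 tv]].
  have ut : hexgrid k u t.
    by rewrite hexgridE t2 eqxx; move: tv; case: ifP => _ ->; rewrite eqxx orbT.
  move: ft; rewrite pattern_ofE => /asboolP/(uniq_s _ ut) ts.
  by move: t2; rewrite ts s2; lia.
Qed.

Lemma hlone_below : below k (hlone k f).
Proof. by move=> i c /and4P[]. Qed.

Lemma vert_mate (u s t : hex_vertex k) :
  (s.2 = u.2 /\ (if down u.1 u.2 then s.1 = u.1.+1 :> nat else u.1 = s.1.+1 :> nat)) ->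
  (t.2 = u.2 /\ (if down u.1 u.2 then t.1 = u.1.+1 :> nat else u.1 = t.1.+1 :> nat)) ->
  s = t.
Proof.
move=> [s2 s1] [t2 t1]; apply: hex_vertex_eq; last by rewrite s2 t2.
by move: s1 t1; case: ifP => _ => [-> ->|-> []].
Qed.

Lemma lone_vertP (u s : hex_vertex k) : S s -> u.2 = s.2 ->
  (if down s.1 s.2 then u.1 = s.1.+1 :> nat else s.1 = u.1.+1 :> nat) ->
  reflect (sole u s) (lone_vert k f s.1 s.2).
Proof.
move=> Ss u2 u1.
have su : s.2 = u.2 /\
    (if down u.1 u.2 then s.1 = u.1.+1 :> nat else u.1 = s.1.+1 :> nat).
  split=> //; rewrite u2; case: ifP u1 => dn u1.
    by rewrite u1 downS dn.
  by rewrite u1 downS in dn; rewrite (negbFE dn).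
have us : hexgrid k u s.
  by rewrite hexgridE; case: su => -> /=; case: ifP => _ ->; rewrite !eqxx orbT.
apply: (iffP andP).
  case=> _ /(vertP _ hlone_below (ltn_ord _))[u' hu' u'P].
  rewrite (vert_mate (conj u2 u1) u'P) in su us *.
  case/and4P: hu' => _ fu fl fr; split=> //.
    by apply/asboolPn; rewrite -pattern_ofE.
  move=> t ut /asboolP; rewrite -pattern_ofE => ft.
  case: (hexgrid_cases ut) => [[t1 t2]|[t1 t2]|tv].
  - by move: ft fr; rewrite t1 t2 => ->.
  - by move: ft fl; rewrite t1 t2 => ->.
  - exact: vert_mate tv su.
case=> Su _ _ uniq_s; split; first by rewrite pattern_ofE; apply/asboolP.
apply/(vertP _ hlone_below (ltn_ord _)); exists u => //; apply/and4P; split=> //.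
- by rewrite pattern_ofE; apply/asboolPn.
- apply/negP => /pattern_ofP[ik St].
  have /(uniq_s _)/(_ St)/(congr1 snd)/= :
    hexgrid k u (Ordinal ik, u.2 - 1) by rewrite hexgridE !eqxx orbT.
  by rewrite u2; lia.
- apply/negP => /pattern_ofP[ik St].
  have /(uniq_s _)/(_ St)/(congr1 snd)/= :
    hexgrid k u (Ordinal ik, u.2 + 1) by rewrite hexgridE !eqxx.
  by rewrite u2; lia.
Qed.

Lemma sole_uniq : lds (hexgrid k) S ->
  forall u v s, sole u s -> sole v s -> u = v.
Proof.
move=> [_ sep] u v s [Su us Ss us_uniq] [Sv vs _ vs_uniq].
apply: contrapT => uv; apply: sep uv _ => //.
by apply/seteqP; split=> t [/= ht St];
  [rewrite (us_uniq _ ht St)|rewrite (vs_uniq _ ht St)]; split.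
Qed.

Lemma lds_locdom : lds (hexgrid k) S -> locdom k f.
Proof.
move=> ldsS; have sole_inj := sole_uniq ldsS; case: ldsS => dom _.
split=> [|i j ik|i j fij]; first exact: pattern_of_below.
  case fij: (f i j) => //=; pose u : hex_vertex k := (Ordinal ik, j).
  have Su : ~ S u by apply/asboolPn; rewrite -pattern_ofE fij.
  have [t [/hexgrid_cases ut /asboolP]] := dom u Su; rewrite -pattern_ofE => ft.
  case: ut => [[t1 t2]|[t1 t2]|tv].
  - by move: ft; rewrite t1 t2 /= => ->; rewrite orbT.
  - by move: ft; rewrite t1 t2 /= => ->.
  - suff -> : vert f i j by rewrite !orbT.
    by apply/(vertP _ pattern_of_below ik); exists t.
have [ik Ss] := pattern_ofP _ _ fij.
set s : hex_vertex k := (Ordinal ik, j) in Ss.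
pose a : hex_vertex k := (Ordinal ik, j - 1).
pose b : hex_vertex k := (Ordinal ik, j + 1).
have sa : lone_right f i (j - 1) -> sole a s.
  by move/(@lone_rightP a s erefl); apply; rewrite /= subrK.
have sb : lone_left f i (j + 1) -> sole b s.
  by move/(@lone_leftP b s erefl); apply; rewrite /= addrK.
have sc : lone_vert k f i j -> exists2 c : hex_vertex k, sole c s & c.2 = j.
  move=> lv; have /andP[_ /(vertP _ hlone_below ik)[c _ [c2 c1]]] := lv.
  by exists c => //; apply/(@lone_vertP c s).
have ab : a <> b by move/(congr1 snd) => /=; lia.
case: (boolP (lone_right f i (j - 1))) => [/sa{}sa|_];
  case: (boolP (lone_left f i (j + 1))) => [/sb{}sb|_];
  case: (boolP (lone_vert k f i j)) => [/sc[c {}sc c2]|_] //.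
- by case: ab; apply: sole_inj sa sb.
- by case: ab; apply: sole_inj sa sb.
- by move: c2; rewrite (sole_inj _ _ _ sc sa) /=; lia.
- by move: c2; rewrite (sole_inj _ _ _ sc sb) /=; lia.
Qed.

(** Two vertices with equal traces would both be [sole] for the same s, giving s two lone
    neighbours. *)
Lemma locdom_lds : locdom k f -> lds (hexgrid k) S.
Proof.
move=> ldf.
have dom u : ~ S u -> neighbors (hexgrid k) u `&` S !=set0.
  move=> Su.
  have := locdom_dom ldf u.2 (ltn_ord u.1).
  rewrite pattern_ofE (asboolF Su) /= => /or3P[/pattern_ofP[ik St]|/pattern_ofP[ik St]|].
  - by exists (Ordinal ik, u.2 - 1); split=> //; rewrite /neighbors /= hexgridE !eqxx orbT.
  - by exists (Ordinal ik, u.2 + 1); split=> //; rewrite /neighbors /= hexgridE !eqxx.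
  - move=> /(vertP _ pattern_of_below (ltn_ord _))[t ft [t2 t1]]; exists t; split.
      by rewrite /= /neighbors /= hexgridE t2; case: ifP t1 => _ ->; rewrite !eqxx orbT.
    by apply/asboolP; rewrite -pattern_ofE.
split=> // u v Su Sv uv NuNv.
have [s [us Ss]] := dom u Su.
have [vs _] : (neighbors (hexgrid k) v `&` S) s by rewrite -NuNv; split.
have sep_u t : hexgrid k u t -> S t -> t = s.
  move=> ut St; have [vt _] : (neighbors (hexgrid k) v `&` S) t by rewrite -NuNv; split.
  exact: (hexgrid_square_free ut us vt vs uv).
have sep_v t : hexgrid k v t -> S t -> t = s.
  move=> vt St; have [ut _] : (neighbors (hexgrid k) u `&` S) t by rewrite NuNv; split.
  exact: (hexgrid_square_free ut us vt vs uv).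
have su : sole u s by split.
have sv : sole v s by split.
have fs : f s.1 s.2 by rewrite pattern_ofE; apply/asboolP.
have := locdom_lone ldf fs.
have lone_cases w : sole w s ->
  [\/ lone_right f s.1 (s.2 - 1) /\ w = (s.1, s.2 - 1),
      lone_left f s.1 (s.2 + 1) /\ w = (s.1, s.2 + 1) |
      lone_vert k f s.1 s.2 /\ (w.2 = s.2 /\
       (if down s.1 s.2 then w.1 = s.1.+1 :> nat else s.1 = w.1.+1 :> nat))].
  move=> sw; have [_ ws _ _] := sw.
  have := ws; rewrite hexgrid_sym => /hexgrid_cases[[w1 w2]|[w1 w2]|wv].
  - constructor 2; split; last by apply: hex_vertex_eq.
    by rewrite -w1 -w2; apply/(@lone_leftP w s) => //; rewrite w2 addrK.
  - constructor 1; split; last by apply: hex_vertex_eq.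
    by rewrite -w1 -w2; apply/(@lone_rightP w s) => //; rewrite w2 subrK.
  - by constructor 3; split=> //; case: wv => w2 w1; apply/(@lone_vertP w s).
case: (lone_cases u su) => -[-> uE]; case: (lone_cases v sv) => -[le vE].
- by case: uv; rewrite uE vE.
- by rewrite le; case: lone_vert.
- by rewrite le; case: lone_left.
- by rewrite le; case: lone_vert.
- by case: uv; rewrite uE vE.
- by rewrite le; case: lone_right.
- by rewrite le; case: lone_left.
- by rewrite le; case: lone_right.
- by case: uv; apply: vert_mate uE vE.
Qed.

End LocatingDominating.

(** * Densities *)

Section UpperLimit.
Variables (R : realType) (b n : nat -> nat) (A P k C : nat).
Hypotheses (P0 : (0 < P)%N) (k0 : (0 < k)%N).
Let u (r : nat) : \bar R := ((b r)%:R / (n r)%:R)%:E.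

Let exists_large (x : R) : exists r0 : nat, forall r, (r0 <= r)%N ->
  x <= (2 * r + 1)%N%:R.
Proof.
exists (Num.bound `|x|) => r hr; apply: le_trans (ler_norm x) _.
apply: le_trans (ltW (archi_boundP (normr_ge0 x))) _.
by rewrite ler_nat (leq_trans hr) //; lia.
Qed.

Lemma limn_esup_ratio_ge :
  (forall r, (A * (2 * r + 1) <= P * b r + C)%N) ->
  (forall r, (n r <= k * (2 * r + 1))%N) ->
  (exists r0, forall r, (r0 <= r)%N -> (0 < n r)%N) ->
  ((A%:R / (P * k)%N%:R)%:E <= limn_esup u)%E.
Proof.
move=> hb hn [r0 hr0]; apply: le_ereal_inf_tmp => _ [V /= [N _ NV] <-].
apply/lee_subgt0Pr => e e0.
have [r1 hr1] := exists_large (C%:R / (e * (P * k)%N%:R)).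
pose r := maxn N (maxn r0 r1).
have Vr : V r by apply: NV; rewrite /= leq_maxl.
apply: le_ereal_sup_tmp; exists (u r); first by exists r.
have n0 : (0 < n r)%N by apply: hr0; rewrite /r; lia.
rewrite /u lee_fin; set x : R := (2 * r + 1)%N%:R.
have x0 : 0 < x by rewrite ltr0n; lia.
have hx : C%:R <= x * (e * (P * k)%N%:R).
  rewrite -ler_pdivrMr ?mulr_gt0 ?ltr0n ?muln_gt0 ?P0 //.
  by apply: hr1; rewrite /r; lia.
have Pk0 : 0 < (P * k)%N%:R :> R by rewrite ltr0n muln_gt0 P0.
have n0' : 0 < (n r)%:R :> R by rewrite ltr0n.
have hnx : (n r)%:R <= k%:R * x :> R by rewrite -natrM ler_nat.
have hbx : A%:R * x <= P%:R * (b r)%:R + C%:R :> R by rewrite -!natrM -natrD ler_nat.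
(* The upper bound on [n r] can only be multiplied by a nonnegative factor. *)
have [neg|pos] := lerP (A%:R / (P * k)%N%:R - e) 0.
  by apply: le_trans neg _; rewrite divr_ge0.
rewrite ler_pdivlMr //; apply: le_trans (ler_wpM2l (ltW pos) hnx) _.
have -> : (A%:R / (P * k)%N%:R - e) * (k%:R * x) =
    (A%:R * x - x * (e * (P * k)%N%:R)) / P%:R.
  have PR : P%:R != 0 :> R by rewrite pnatr_eq0 -lt0n.
  have kR : k%:R != 0 :> R by rewrite pnatr_eq0 -lt0n.
  by rewrite natrM; field; rewrite PR kR.
by rewrite ler_pdivrMr ?ltr0n // mulrC; lra.
Qed.

Lemma limn_esup_ratio_le :
  (forall r, (P * b r <= A * (2 * r + 1) + C)%N) ->
  (forall r, (k * (2 * r + 1) <= n r + C)%N) ->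
  (limn_esup u <= (A%:R / (P * k)%N%:R)%:E)%E.
Proof.
move=> hb hn; apply/lee_addgt0Pr => e e0.
set d : R := A%:R / (P * k)%N%:R.
have Pk0 : 0 < (P * k)%N%:R :> R by rewrite ltr0n muln_gt0 P0.
have d0 : 0 <= d by rewrite divr_ge0.
have [r1 hr1] := exists_large ((C%:R + (d + e) * P%:R * C%:R) / (e * (P * k)%N%:R)).
(* Beyond [r1] the additive errors are absorbed by [e]; beyond [C] the denominator is positive. *)
apply: (@le_trans _ _ (ereal_sup (u @` [set r | (maxn r1 C <= r)%N]))).
  apply: ereal_inf_lbound; exists [set r | (maxn r1 C <= r)%N] => //.
  by exists (maxn r1 C).
apply: ge_ereal_sup => _ [r /= hr <-]; rewrite /u lee_fin -/d.
set x : R := (2 * r + 1)%N%:R.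
have n0 : (0 < n r)%N by have := hn r; nia.
have hx : C%:R + (d + e) * P%:R * C%:R <= x * (e * (P * k)%N%:R).
  rewrite -ler_pdivrMr ?mulr_gt0 //.
  by apply: hr1; lia.
have n0' : 0 < (n r)%:R :> R by rewrite ltr0n.
have hnx : k%:R * x <= (n r)%:R + C%:R :> R by rewrite -natrM -natrD ler_nat.
have hbx : P%:R * (b r)%:R <= A%:R * x + C%:R :> R by rewrite -!natrM -natrD ler_nat.
rewrite ler_pdivrMr // -(ler_pM2l (_ : 0 < P%:R :> R)) ?ltr0n //.
apply: le_trans hbx _; rewrite mulrA.
have : (d + e) * P%:R * (k%:R * x) <= (d + e) * P%:R * ((n r)%:R + C%:R).
  by rewrite ler_wpM2l // mulr_ge0 // addr_ge0 // ltW.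
have -> : (d + e) * P%:R * (k%:R * x) = A%:R * x + x * (e * (P * k)%N%:R).
  have PR : P%:R != 0 :> R by rewrite pnatr_eq0 -lt0n.
  have kR : k%:R != 0 :> R by rewrite pnatr_eq0 -lt0n.
  by rewrite /d natrM; field; rewrite PR kR.
by rewrite mulrDr; move: hx; rewrite [P%:R * (d + e)]mulrC; lra.
Qed.
End UpperLimit.

Lemma card_fset_set_count (T : choiceType) (A : set T) (s : seq T) :
  uniq s -> (forall x, A x -> x \in s) ->
  #|` fset_set A| = count (fun x => `[< A x >]) s.
Proof.
move=> us As; pose l := [seq x <- s | `[< A x >]].
have AE : A = [set` [fset x in l]%fset].
  apply/seteqP; split=> x /=; rewrite !inE /l mem_filter.
    by move=> Ax; apply/andP; split; [exact/asboolP|exact: As].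
  by case/andP=> /asboolP.
by rewrite {1}AE set_fsetK card_imfset //= undup_id ?filter_uniq // size_filter.
Qed.

(** * Comparison of balls with blocks of columns *)

Section Balls.
Variables (R : realType) (k : nat).
Implicit Types (u v : hex_vertex k) (S : set (hex_vertex k)).
Let e := hexgrid k.
Local Notation dist := (graph_dist R (hexgrid k)).
Local Notation ball := (punctured_ball R (hexgrid k)).

Lemma path_col_dist u p : path e u p -> (`|(last u p).2 - u.2| <= size p)%N.
Proof.
elim: p u => [|w p IH] u /=; first by rewrite subrr.
by case/andP=> /hexgrid_cases uw /IH; case: uw => [[_ ->]|[_ ->]|[-> _]]; lia.
Qed.

Lemma walk_row (i : 'I_k) (j : int) (n : nat) (s : bool) : exists2 p,
  path e (i, j) p & last (i, j) p = (i, if s then j + n%:Z else j - n%:Z) /\ size p = n.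
Proof.
elim: n => [|n [p pp [lp sp]]].
  by exists [::] => //; split=> //; case: s; rewrite /= ?addr0 ?subr0.
exists (rcons p (i, if s then j + n.+1%:Z else j - n.+1%:Z)).
  rewrite rcons_path pp lp /e hexgridE /= eqxx /=.
  by case: s {lp}; apply/orP; left; apply/orP; [left|right]; apply/eqP; lia.
by rewrite last_rcons size_rcons sp.
Qed.

Lemma walk_down (i i' : 'I_k) (j : int) : i' = i.+1 :> nat -> exists2 p,
  path e (i, j) p & last (i, j) p = (i', j) /\ (size p <= 3)%N.
Proof.
move=> ii'; case dij: (down i j).
  by exists [:: (i', j)] => //; rewrite /= andbT /e hexgridE /= dij eqxx ii' eqxx orbT.
exists [:: (i, j + 1); (i', j + 1); (i', j)] => //.
by rewrite /= andbT /e !hexgridE /= down_next dij /= addrK ii' !eqxx !orbT.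
Qed.

Lemma walk_up (i i' : 'I_k) (j : int) : i = i'.+1 :> nat -> exists2 p,
  path e (i, j) p & last (i, j) p = (i', j) /\ (size p <= 3)%N.
Proof.
move=> ii'; case dij: (down i j); last first.
  by exists [:: (i', j)] => //; rewrite /= andbT /e hexgridE /= dij eqxx ii' eqxx orbT.
exists [:: (i, j + 1); (i', j + 1); (i', j)] => //.
by rewrite /= andbT /e !hexgridE /= down_next dij /= addrK ii' !eqxx !orbT.
Qed.

(** A vertical move costs one edge, or three with a detour through the next column when the parity
    is wrong. *)
Lemma walk_col (i i' : 'I_k) (j : int) : exists2 p,
  path e (i, j) p & last (i, j) p = (i', j) /\ (size p <= 3 * `|i%:Z - i'%:Z|)%N.
Proof.
have [n] := ubnP `|i%:Z - i'%:Z|%N; elim: n => // n IH in i *.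
have cat_walk (m : 'I_k) p : path e (i, j) p -> last (i, j) p = (m, j) ->
    (size p <= 3)%N -> (`|i%:Z - i'%:Z| = `|m%:Z - i'%:Z|.+1)%N ->
    (`|i%:Z - i'%:Z| < n.+1)%N ->
    exists2 q, path e (i, j) q &
      last (i, j) q = (i', j) /\ (size q <= 3 * `|i%:Z - i'%:Z|)%N.
  move=> pp lp sp dE dn; have [|q pq [lq sq]] := IH m; first by lia.
  exists (p ++ q); first by rewrite cat_path pp lp.
  by rewrite last_cat lp size_cat; split=> //; lia.
case: (ltngtP i i') => ii'.
- have mk : (i.+1 < k)%N by apply: leq_ltn_trans ii' (ltn_ord i').
  have [p pp [lp sp]] := @walk_down i (Ordinal mk) j erefl.
  by apply: (cat_walk (Ordinal mk) p) => //=; lia.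
- have mk : (i.-1 < k)%N by have := ltn_ord i; lia.
  have [|p pp [lp sp]] := @walk_up i (Ordinal mk) j; first by rewrite /= prednK //; lia.
  by apply: (cat_walk (Ordinal mk) p) => //=; lia.
- by move=> _; exists [::] => //; split=> //=; rewrite (val_inj ii').
Qed.

Lemma walk u v : exists2 p, path e u p &
  last u p = v /\ (size p <= `|v.2 - u.2| + 3 * k)%N.
Proof.
case: u v => [i j] [i' j'].
have [p pp [lp sp]] := walk_row i j `|j' - j| (j <= j').
have [q pq [lq sq]] := walk_col i i' j'.
have jE : (if j <= j' then j + `|j' - j|%N%:Z else j - `|j' - j|%N%:Z) = j'.
  by case: ifP; lia.
rewrite jE in lp; exists (p ++ q); first by rewrite cat_path pp lp.
rewrite last_cat lp size_cat sp; split=> //=.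
rewrite leq_add2l (leq_trans sq) // leq_mul2l /=; clear.
by have := ltn_ord i; have := ltn_ord i'; lia.
Qed.

Lemma ball_col r u v : ball r v u -> (`|u.2 - v.2| <= r)%N.
Proof.
case=> _ dr; rewrite -(ler_nat R) -lee_fin; apply: le_trans dr.
apply: le_ereal_inf_tmp => _ [p [pp lp] <-]; rewrite lee_fin ler_nat.
by have := path_col_dist pp; rewrite lp distnC.
Qed.

Lemma col_ball r u v : u <> v -> (`|u.2 - v.2| + 3 * k <= r)%N -> ball r v u.
Proof.
move=> uv ur; split.
  apply: (@lt_le_trans _ _ 1%:E); first by rewrite lte01.
  apply: le_ereal_inf_tmp => _ [[|w p] [pp lp] <-]; first by case: uv.
  by rewrite lee_fin ler1n.
have [p pp [lp sp]] := walk u v.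
apply: (@le_trans _ _ (size p)%:R%:E); first by apply: ereal_inf_lbound; exists p.
by rewrite lee_fin ler_nat; lia.
Qed.

End Balls.

Section Counting.
Variables (R : realType) (k : nat).
Implicit Types (u v : hex_vertex k) (S : set (hex_vertex k)).
Local Notation ball := (punctured_ball R (hexgrid k)).

Definition box r (j : int) : seq (hex_vertex k) :=
  [seq (i, j - r%:Z + t%:Z) | t <- iota 0 (2 * r + 1), i <- enum 'I_k].

Lemma mem_box r j u : (u \in box r j) = (`|u.2 - j| <= r)%N.
Proof.
apply/allpairsP/idP => [[[t i] /= [+ _ ->]]|ur].
  by rewrite mem_iota /=; lia.
exists (`|(u.2 - j + r%:Z)%R|%N, u.1); rewrite /= mem_iota mem_enum; split=> //.
  lia.
by apply: hex_vertex_eq => //=; lia.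
Qed.

Lemma uniq_box r j : uniq (box r j).
Proof.
apply: allpairs_uniq; rewrite ?iota_uniq ?enum_uniq //.
by move=> [t i] [t' i'] _ _ /= [-> tt']; congr pair; lia.
Qed.

Lemma count_box S r (j : int) : count (fun u => `[< S u >]) (box r j) =
  (\sum_(t < 2 * r + 1) colsum k (pattern_of S) (j - r%:Z + t%:Z)%R)%N.
Proof.
rewrite -(big_mkord xpredT (fun t => colsum k (pattern_of S) (j - r%:Z + t%:Z))).
rewrite /index_iota subn0 /box; elim: (iota 0 _) => [|t s IH]; first by rewrite big_nil.
rewrite big_cons /= count_cat IH; congr (_ + _)%N.
rewrite count_map /colsum -sum1_count big_mkcond big_enum /=.
by apply: eq_bigr => i _; rewrite (pattern_ofE S (i, _)); case: asboolP.
Qed.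

Lemma ball_count_le S r v :
  (#|` fset_set (ball r v `&` S)| <= count (fun u => `[< S u >]) (box r v.2))%N.
Proof.
rewrite (@card_fset_set_count _ _ (box r v.2)) ?uniq_box //.
  by apply: sub_count => u /asboolP[_ Su]; apply/asboolP.
by move=> u [/ball_col]; rewrite mem_box.
Qed.

(** The ball contains every vertex within r - 3 k columns except its centre, which accounts for the
    1. *)
Lemma ball_count_ge S r v : (3 * k <= r)%N ->
  (count (fun u => `[< S u >]) (box (r - 3 * k) v.2) <=
   #|` fset_set (ball r v `&` S)| + 1)%N.
Proof.
move=> kr; rewrite (@card_fset_set_count _ _ (box r v.2)) ?uniq_box //; last first.
  by move=> u [/ball_col]; rewrite mem_box.
set s := box _ _; set T := fun u => `[< S u >].
have -> : (count T s = count (predI T (predC1 v)) s + count (predI T (pred1 v)) s)%N.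
  rewrite -count_predUI [count (predI _ _) s in RHS](_ : _ = 0%N) ?addn0.
    by apply: eq_count => u /=; case: (T u); case: (u == v).
  apply/eqP; rewrite -leqn0 -[0%N](count_pred0 s); apply: sub_count => u /=.
  by case: (T u); case: (u == v).
apply: leq_add; last first.
  apply: leq_trans (_ : count_mem v s <= 1)%N; first by apply: sub_count => u /andP[].
  by rewrite count_uniq_mem ?uniq_box //; case: (_ \in _).
rewrite -!size_filter; apply: uniq_leq_size; first by rewrite filter_uniq ?uniq_box.
move=> u; rewrite !mem_filter !mem_box /= => /andP[/andP[/asboolP Su /eqP uv] ur].
apply/andP; split; last by lia.
by apply/asboolP; split=> //; apply: col_ball => //; lia.
Qed.

Lemma count_boxT r j :
  (count (fun u => `[< [set: hex_vertex k] u >]) (box r j) = k * (2 * r + 1))%N.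
Proof.
rewrite (eq_count (_ : _ =1 xpredT)); last by move=> u; apply/asboolP.
by rewrite count_predT size_allpairs size_iota size_enum_ord mulnC.
Qed.

Lemma ball_size_le r v : (#|` fset_set (ball r v)| <= k * (2 * r + 1))%N.
Proof. by have := ball_count_le setT r v; rewrite setIT count_boxT. Qed.

Lemma ball_size_ge r v :
  (k * (2 * r + 1) <= #|` fset_set (ball r v)| + (k * (6 * k + 1) + 1))%N.
Proof.
have [rk|kr] := ltnP r (3 * k).
  apply: leq_trans (leq_addl _ _); apply: leq_trans (leq_addr _ _).
  by rewrite leq_mul2l; lia.
have := ball_count_ge setT v kr; rewrite setIT count_boxT.
have : (k * (2 * r + 1) <= k * (2 * (r - 3 * k) + 1) + k * (6 * k + 1))%N.
  by rewrite -mulnDr leq_mul2l; lia.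
by lia.
Qed.

Lemma density_ge S A P C : (0 < P)%N -> (0 < k)%N ->
  (forall (j : int) n,
    A * n <= P * \sum_(t < n) colsum k (pattern_of S) (j + t%:Z)%R + C)%N ->
  ((A%:R / (P * k)%N%:R)%:E <= density R (hexgrid k) S)%E.
Proof.
move=> P0 k0 hS; apply: le_ereal_inf_tmp => _ [v _ <-].
(* [P] pays for the missing centre and A (6 k + 1) for the 6 k columns cut off, or for the whole
   ball when r < 3 k. *)
apply: (@limn_esup_ratio_ge _ _ _ A P k (C + P + A * (6 * k + 1))) => //.
- move=> r; have [rk|kr] := ltnP r (3 * k).
    do 2!apply: leq_trans (leq_addl _ _).
    by rewrite leq_mul2l; lia.
  have := ball_count_ge S v kr; rewrite count_box.
  have := hS (v.2 - (r - 3 * k)%N%:Z) (2 * (r - 3 * k) + 1)%N.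
  move: (\sum_(t < _) _)%N (#|` _|) => s b h1 h2.
  have : (A * (2 * r + 1) = A * (2 * (r - 3 * k) + 1) + A * (6 * k))%N.
    by rewrite -mulnDr; congr (_ * _)%N; lia.
  have : (P * s <= P * b + P)%N by rewrite -mulnSr leq_mul2l -addn1 h2 orbT.
  by move: h1; rewrite mulnDr; lia.
- by move=> r; apply: ball_size_le.
- exists (3 * k + 1)%N => r hr; have := ball_size_ge r v; nia.
Qed.

Lemma density_le S A P C v : (0 < P)%N -> (0 < k)%N ->
  (forall (j : int) n,
    P * \sum_(t < n) colsum k (pattern_of S) (j + t%:Z)%R <= A * n + C)%N ->
  (density R (hexgrid k) S <= (A%:R / (P * k)%N%:R)%:E)%E.
Proof.
move=> P0 k0 hS; apply: (@le_trans _ _ (density_at R (hexgrid k) v S)).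
  by apply: ereal_inf_lbound; exists v.
apply: (@limn_esup_ratio_le _ _ _ A P k (C + (k * (6 * k + 1) + 1))) => //.
- move=> r; rewrite addnA (leq_trans _ (leq_addr _ _)) //.
  apply: leq_trans (hS (v.2 - r%:Z) _); rewrite leq_mul2l -count_box.
  by rewrite ball_count_le orbT.
- by move=> r; rewrite addnCA (leq_trans (ball_size_ge r v)) // leq_addl.
Qed.

End Counting.

Section Densities.
Variable R : realType.

Lemma ratio_eq (a b c d : nat) : (0 < b)%N -> (0 < d)%N -> (a * d = c * b)%N ->
  a%:R / b%:R = c%:R / d%:R :> R.
Proof.
move=> b0 d0 E; apply/eqP; rewrite eqr_div ?pnatr_eq0 -?lt0n //.
by rewrite -!natrM E.
Qed.

Lemma min_density_ge k p q N : (0 < k)%N -> (0 < p)%N ->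
  (forall f, locdom k f -> prefix_good k f p q N) ->
  (((2 * k * p + q)%:R / (6 * p * k)%:R)%:E <= min_density R (hexgrid k))%E.
Proof.
move=> k0 p0 good; apply: le_ereal_inf_tmp => _ [S ldsS <-].
have ldf := lds_locdom ldsS.
apply: (@density_ge R k S _ _ (8 * k * p + q * N)) => //; first by lia.
by move=> j n; apply: locdom_density_ge ldf (good _ ldf).
Qed.

Lemma tiling_density k p N : (0 < k)%N -> (0 < p)%N -> tiling k p N ->
  exists S : set (hex_vertex k), [/\ lds (hexgrid k) S, col_periodic p S &
    density R (hexgrid k) S = (N%:R / (p * k)%:R)%:E].
Proof.
move=> k0 p0 [f [ldf perf sumf]];
pose S : set (hex_vertex k) := [set v : hex_vertex k | f v.1 v.2].
have SE : pattern_of S = f.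
  apply/funext => i; apply/funext => j; apply/idP/idP; first by case/asboolP.
  by move=> fij; apply/asboolP; exists (locdom_below ldf fij).
exists S; split.
- by apply: locdom_lds; rewrite SE.
- split=> // i j; rewrite /S /=.
  by have := perf i j 1; rewrite mul1r => ->.
- apply/eqP; rewrite eq_le; apply/andP; split.
    apply: (@density_le R k S N p (p * (k * p)) (Ordinal k0, 0)) => // j n.
    by rewrite SE; have [] := periodic_sum p0 sumf j n.
  apply: (@density_ge R k S N p (N * p)) => // j n.
  by rewrite SE; have [] := periodic_sum p0 sumf j n.
Qed.

Lemma min_density_tiling k p N a b : (0 < k)%N -> (0 < p)%N -> (0 < b)%N ->
  (a * (p * k) = N * b)%N -> tiling k p N ->
  (min_density R (hexgrid k) <= (a%:R / b%:R)%:E)%E.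
Proof.
move=> k0 p0 b0 E /(tiling_density k0 p0)[S [ldsS _ dS]].
have -> : a%:R / b%:R = N%:R / (p * k)%:R :> R by apply: ratio_eq; rewrite ?muln_gt0 ?p0.
by rewrite -dS; apply: ereal_inf_lbound; exists S.
Qed.

Lemma min_density_eq k p q N p' N' a b :
  (0 < k)%N -> (0 < p)%N -> (0 < p')%N -> (0 < b)%N ->
  (a * (6 * p * k) = (2 * k * p + q) * b)%N -> (a * (p' * k) = N' * b)%N ->
  (forall f, locdom k f -> prefix_good k f p q N) -> tiling k p' N' ->
  min_density R (hexgrid k) = (a%:R / b%:R)%:E.
Proof.
move=> k0 p0 p'0 b0 E E' good til; apply/eqP; rewrite eq_le.
rewrite (min_density_tiling _ _ _ E' til) //=.
rewrite (_ : a%:R / b%:R = (2 * k * p + q)%:R / (6 * p * k)%:R).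
  exact: min_density_ge good.
by apply: ratio_eq => //; rewrite !muln_gt0 p0.
Qed.

Lemma min_density_check k p q N p' N' a b : check k p q N ->
  (0 < k)%N -> (0 < p)%N -> (0 < p')%N -> (0 < b)%N ->
  (a * (6 * p * k) = (2 * k * p + q) * b)%N -> (a * (p' * k) = N' * b)%N ->
  tiling k p' N' -> min_density R (hexgrid k) = (a%:R / b%:R)%:E.
Proof.
move=> chk k0 p0 p'0 b0 E E'; apply: min_density_eq E E' _ => // f ldf.
exact: check_prefix_good chk.
Qed.

End Densities.

(** * The theorem *)

(* The tables list, row by row, the columns of the vertices within a period.  *)
(* They were found as cycles with few defects in the graph of scan states.    *)
Lemma tiling1 : tiling 1 10 4.
Proof.
by apply: (@tiling_tableP
  [:: [:: 0; 2; 5; 7]]) => //; vm_compute.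
Qed.

Lemma tiling2 : tiling 2 8 6.
Proof.
by apply: (@tiling_tableP
  [:: [:: 0; 3; 5];
      [:: 1; 3; 6]]) => //; vm_compute.
Qed.

Lemma tiling4 : tiling 4 16 22.
Proof.
by apply: (@tiling_tableP
  [:: [:: 2; 5; 7; 10; 13; 15];
      [:: 1; 4; 8; 11; 14];
      [:: 0; 3; 6; 9; 12];
      [:: 2; 5; 7; 10; 13; 15]]) => //; vm_compute.
Qed.

Lemma tiling5 : tiling 5 14 24.
Proof.
by apply: (@tiling_tableP
  [:: [:: 3; 5; 8; 11; 13];
      [:: 1; 4; 7; 9; 12];
      [:: 0; 2; 7; 9];
      [:: 0; 2; 5; 8; 11];
      [:: 1; 4; 6; 10; 12]]) => //; vm_compute.
Qed.

Lemma tiling7 : tiling 7 22 52.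
Proof.
by apply: (@tiling_tableP
  [:: [:: 1; 4; 7; 9; 12; 15; 17; 21];
      [:: 0; 3; 6; 10; 13; 16; 19];
      [:: 2; 5; 8; 11; 14; 18; 20];
      [:: 1; 4; 7; 9; 12; 15; 18; 20];
      [:: 0; 3; 7; 9; 13; 16; 19];
      [:: 2; 5; 8; 11; 14; 17; 21];
      [:: 1; 4; 6; 10; 12; 15; 18; 20]]) => //; vm_compute.
Qed.

Lemma tiling8 : tiling 8 20 54.
Proof.
by apply: (@tiling_tableP
  [:: [:: 2; 5; 7; 11; 13; 17; 19];
      [:: 1; 3; 6; 9; 12; 15; 18];
      [:: 1; 3; 8; 10; 14; 16];
      [:: 2; 5; 8; 10; 14; 16; 19];
      [:: 0; 4; 6; 9; 12; 15; 18];
      [:: 0; 4; 6; 11; 13; 18];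
      [:: 2; 5; 8; 11; 13; 16; 19];
      [:: 1; 3; 7; 9; 12; 15; 17]]) => //; vm_compute.
Qed.

(** In these four checks (2 k p + q) / (6 p k) is 12/30, 9/24, 33/96 and 72/210; the last argument
    bounds the window length. *)
Lemma check1 : check 1 5 2 5.
Proof. by vm_compute. Qed.

Lemma check2 : check 2 2 1 8.
Proof. by vm_compute. Qed.

Lemma check4 : check 4 4 1 9.
Proof. by vm_compute. Qed.

Lemma check5 : check 5 7 2 9.
Proof. by vm_compute. Qed.

Theorem theorem8 (R : realType) :
  (* (a) *)
  [/\ min_density R (hexgrid 1) = (2 / 5)%:E,
      min_density R (hexgrid 2) = (3 / 8)%:E,
      min_density R (hexgrid 4) = (11 / 32)%:E &
      min_density R (hexgrid 5) = (12 / 35)%:E] /\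
  (exists S7 : set (hex_vertex 7),
     [/\ lds (hexgrid 7) S7,
         col_periodic 22 S7,
         (min_density R (hexgrid 7) <= density R (hexgrid 7) S7)%E &
         density R (hexgrid 7) S7 = (26 / 77)%:E]) /\
  (exists S8 : set (hex_vertex 8),
     [/\ lds (hexgrid 8) S8,
         col_periodic 20 S8,
         (min_density R (hexgrid 8) <= density R (hexgrid 8) S8)%E &
         density R (hexgrid 8) S8 = (27 / 80)%:E]) /\
  (* (b) *)
  (forall m : nat, (1 <= m)%N ->
     min_density R (hexgrid (3 * m)) = (1 / 3)%:E) /\
  (* (c) *)
  (forall m : nat, (3 <= m)%N ->
     (min_density R (hexgrid (3 * m + 1)) <=
      ((11 * m + 4)%:R / (33 * m + 11)%:R)%:E)%E) /\
  (* (d) *)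
  (forall m : nat, (3 <= m)%N ->
     (min_density R (hexgrid (3 * m + 2)) <=
      ((10 * m + 7)%:R / (30 * m + 20)%:R)%:E)%E).
Proof.
split; first split.
- exact: min_density_check check1 _ _ _ _ _ _ tiling1.
- exact: min_density_check check2 _ _ _ _ _ _ tiling2.
- exact: min_density_check check4 _ _ _ _ _ _ tiling4.
- exact: min_density_check check5 _ _ _ _ _ _ tiling5.
split.
  have [//|//|S [ldsS perS dS]] := tiling_density R _ _ tiling7.
  exists S; split=> //; first by apply: ereal_inf_lbound; exists S.
  by rewrite dS; congr EFin; apply: ratio_eq.
split.
  have [//|//|S [ldsS perS dS]] := tiling_density R _ _ tiling8.
  exists S; split=> //; first by apply: ereal_inf_lbound; exists S.
  by rewrite dS; congr EFin; apply: ratio_eq.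
split=> [m m1|].
  have til := tiling_extend m tiling0 isT.
  (* With q = 0 a single column is a good window: the bound 1/3 only uses that defects are
     nonnegative. *)
  apply: (@min_density_eq R (3 * m) 1 0 1 2 (2 * m) 1 3) => //; try lia.
  by move=> f _ j; exists 1%N; rewrite // mul0n.
split=> [m m3|m m3].
  (* This gives 52 + 22 (m - 2) = 22 m + 8 elements among 22 (3 m + 1) vertices; in the last case,
     20 m + 14 among 20 (3 m + 2). *)
  have := tiling_extend (m - 2) tiling7 isT.
  have -> : (7 + 3 * (m - 2) = 3 * m + 1)%N by lia.
  by apply: min_density_tiling => //; lia.
have := tiling_extend (m - 2) tiling8 isT.
have -> : (8 + 3 * (m - 2) = 3 * m + 2)%N by lia.
by apply: min_density_tiling => //; lia.
Qed.
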